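(* Let $E_1,E_2,F$ be (real) Banach lattices. Suppose that $E_1^*$ and $E_2^*$ have order continuous norms and that $A\colon E_1\times E_2\longrightarrow F$ is a positive almost Dunford-Pettis bilinear operator. If either every positive disjoint bounded sequence in $F^*$ is order bounded, or $F^*$ has the dual positive Schur property, then the Aron-Berner extensions $AB_2^\rho(A)\colon E_1^{**}\times E_2^{**}\longrightarrow F^{**}$, $\rho\in S_2$, are weakly positively limited, hence almost Dunford-Pettis.
   Context: A sequence $(x_n)$ in a Banach lattice is disjoint if $|x_n|\wedge|x_k|=0$ for $n\ne k$. A Banach lattice $E$ has the dual positive Schur property if every positive weak$^*$-null sequence in $E^*$ is norm null. A bilinear operator between Banach lattices is positive if it maps pairs of positive elements to positive elements. For Banach lattices $E_1,\ldots,E_m$ and a Banach space $G$, an $m$-linear operator $A\colon E_1\times\cdots\times E_m\to G$ is almost Dunford-Pettis if $(A(x_{1,n},\ldots,x_{m,n}))_{n=1}^\infty$ is norm null in $G$ whenever $(x_{j,n})_{n=1}^\infty$ is a disjoint weakly null sequence in $E_j$, $j=1,\ldots,m$. For Banach lattices $X_1,\ldots,X_m$ and a Banach space $G$, an $m$-linear operator $B\colon X_1^*\times\cdots\times X_m^*\to G$ is weakly positively limited if, for every $j\in\{1,\ldots,m\}$, the sequence $(B(x_{1,n}^*,\ldots,x_{m,n}^* ))_{n=1}^\infty$ is norm null in $G$ whenever $(x_{j,n}^* )_{n=1}^\infty$ is a positive weak$^*$-null sequence in $X_j^*$ and $(x_{i,n}^* )_{n=1}^\infty$ is a positive bounded sequence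 in $X_i^*$ for each $i\neq j$. Here this is applied with $X_i=E_i^*$, so the weak$^*$ topology on $E_i^{**}$ is $\sigma(E_i^{**},E_i^* )$. Aron-Berner extensions of a continuous bilinear operator $A\colon E_1\times E_2\to F$: for $y^*\in F^*$ put $B=y^*\circ A$. For $\rho=\mathrm{id}$, $AB_2^{\mathrm{id}}(A)(x_1^{**},x_2^{**})(y^* )=x_2^{**}\big(x_2\mapsto x_1^{**}(B(\bullet,x_2))\big)$; for $\rho=\theta$ the transposition, $AB_2^{\theta}(A)(x_1^{**},x_2^{**})(y^* )=x_1^{**}\big(x_1\mapsto x_2^{**}(B(x_1,\bullet))\big)$, where $B(\bullet,x_2)\in E_1^*$ and $B(x_1,\bullet)\in E_2^*$ are the functionals $x_1\mapsto B(x_1,x_2)$ and $x_2\mapsto B(x_1,x_2)$. *)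

(* Defs.v *)
From HB Require Import structures.
From mathcomp Require Import all_boot all_order all_algebra all_fingroup.
From mathcomp Require Import all_classical all_reals all_analysis.
Set Implicit Arguments.
Unset Strict Implicit.
Unset Printing Implicit Defensive.
Import Order.TTheory GRing.Theory Num.Theory.
Import numFieldNormedType.Exports.
Local Open Scope classical_set_scope.
Local Open Scope ring_scope.

Reserved Notation "x [<=] y" (at level 70, no associativity).

(* The order is not taken from Order.Lattice: HB cannot join it with the normed
   module hierarchy, because Num.RealDomain already inherits from both without
   a common substructure. *)
HB.mixin Record isBanachLattice (R : realType) E
    of CompleteNormedModule R E := {
  lle : E -> E -> Prop;
  ljoin : E -> E -> E;
  lmeet : E -> E -> E;
  llexx : forall x, lle x x;
  lle_anti : forall x y, lle x y -> lle y x -> x = y;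
  lle_trans : forall y x z, lle x y -> lle y z -> lle x z;
  lleUl : forall x y, lle x (ljoin x y);
  lleUr : forall x y, lle y (ljoin x y);
  lleU : forall x y z, lle x z -> lle y z -> lle (ljoin x y) z;
  lleIl : forall x y, lle (lmeet x y) x;
  lleIr : forall x y, lle (lmeet x y) y;
  lleI : forall x y z, lle z x -> lle z y -> lle z (lmeet x y);
  lleD2r : forall z x y, lle x y -> lle (x + z) (y + z);
  lscale_ge0 : forall (a : R) x, 0 <= a -> lle 0 x -> lle 0 (a *: x);
  lle_norm : forall x y, lle (ljoin x (- x)) (ljoin y (- y)) -> `|x| <= `|y|
}.

#[short(type="banachLatticeType")]
HB.structure Definition BanachLattice (R : realType) :=
  {E of CompleteNormedModule R E & isBanachLattice R E}.

Notation "x [<=] y" := (lle x y).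

Arguments lle_anti {R s x y} _ _.
Arguments lle_trans {R s} y {x z} _ _.
Arguments lleU {R s x y z} _ _.
Arguments lleI {R s x y z} _ _.
Arguments lleD2r {R s} z {x y} _.
Arguments lscale_ge0 {R s a x} _ _.

Definition labs (R : realType) (E : banachLatticeType R) (x : E) : E :=
  ljoin x (- x).

Section BanachLatticeTheory.
Context {R : realType} {E : banachLatticeType R}.
Implicit Types (x y z : E) (a : R).

Lemma lsub_ge0 x y : 0 [<=] y - x <-> x [<=] y.
Proof.
split=> h; first by have := lleD2r x h; rewrite add0r subrK.
by have := lleD2r (- x) h; rewrite subrr.
Qed.

Lemma lleN x y : x [<=] y -> - y [<=] - x.
Proof. by move=> h; apply/lsub_ge0; rewrite opprK addrC; apply/lsub_ge0. Qed.

Lemma lleD x y z t : x [<=] y -> z [<=] t -> x + z [<=] y + t.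
Proof.
move=> h k; apply: (lle_trans (y + z)); first exact: lleD2r.
by rewrite ![y + _]addrC; apply: lleD2r.
Qed.

Lemma laddr_ge0 x y : 0 [<=] x -> 0 [<=] y -> 0 [<=] x + y.
Proof. by move=> h k; have := lleD h k; rewrite addr0. Qed.

Lemma lleZ a x y : 0 <= a -> x [<=] y -> a *: x [<=] a *: y.
Proof.
by move=> a0 /lsub_ge0 h; apply/lsub_ge0; rewrite -scalerBr; exact: lscale_ge0.
Qed.

Lemma lhalf_ge0 x : 0 [<=] x + x -> 0 [<=] x.
Proof.
move=> h; have -> : x = (2^-1 : R) *: (x + x).
  by rewrite -mulr2n -[x *+ 2]scaler_nat scalerA mulVf ?pnatr_eq0// scale1r.
by apply: lscale_ge0 => //; rewrite invr_ge0.
Qed.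

Lemma lle_abs x : x [<=] labs x. Proof. exact: lleUl. Qed.
Lemma lleN_abs x : - x [<=] labs x. Proof. exact: lleUr. Qed.

Lemma labs_ge0 x : 0 [<=] labs x.
Proof.
apply: lhalf_ge0; rewrite -[X in X [<=] _](subrr x).
exact: lleD (lle_abs x) (lleN_abs x).
Qed.

Lemma labs_le x y : x [<=] y -> - x [<=] y -> labs x [<=] y.
Proof. exact: lleU. Qed.

Lemma labs_id x : 0 [<=] x -> labs x = x.
Proof.
move=> x0; apply: lle_anti; last exact: lle_abs.
apply: labs_le; first exact: llexx.
by apply: (lle_trans 0) => //; have := lleN x0; rewrite oppr0.
Qed.

Lemma lnorm_abs x : `|labs x| = `|x|.
Proof.
have h : labs (labs x) = labs x by apply/labs_id/labs_ge0.
by apply/eqP; rewrite eq_le; apply/andP; split; apply: lle_norm;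
  rewrite -/(labs _) -/(labs _) h; exact: llexx.
Qed.

Lemma lnorm_le x y : labs x [<=] y -> `|x| <= `|y|.
Proof.
move=> h; apply: lle_norm; rewrite -/(labs _) -/(labs _).
exact: (lle_trans _ h (lle_abs y)).
Qed.

Lemma lnorm_ge0_le x y : 0 [<=] x -> x [<=] y -> `|x| <= `|y|.
Proof. by move=> x0 xy; apply: lnorm_le; rewrite labs_id. Qed.

Definition lpos x : E := ljoin x 0.
Definition lneg x : E := lpos (- x).

Lemma lpos_ge0 x : 0 [<=] lpos x. Proof. exact: lleUr. Qed.
Lemma lneg_ge0 x : 0 [<=] lneg x. Proof. exact: lpos_ge0. Qed.

Lemma lposBneg x : lpos x - lneg x = x.
Proof.
suff h : lpos x = x + lneg x by rewrite h addrK.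
apply: lle_anti.
  apply: lleU.
    by have := lleD (llexx x) (lneg_ge0 x); rewrite addr0.
  by have := lleD2r x (lleUl (- x) 0); rewrite addNr [_ + x]addrC.
have h : lneg x [<=] lpos x - x.
  apply: lleU; last by apply/lsub_ge0/lleUl.
  by have := lleD2r (- x) (lpos_ge0 x); rewrite add0r.
by have := lleD2r x h; rewrite subrK addrC.
Qed.

Lemma labsE x : labs x = lpos x + lneg x.
Proof.
have half z : z = (2^-1 : R) *: (z + z).
  by rewrite -mulr2n -[z *+ 2]scaler_nat scalerA mulVf ?pnatr_eq0// scale1r.
apply: lle_anti.
  apply: labs_le.
    by have := lleD (lleUl x 0) (lneg_ge0 x); rewrite addr0.
  by have := lleD (lpos_ge0 x) (lleUl (- x) 0); rewrite add0r.
have h : lpos x [<=] (2^-1 : R) *: (labs x + x).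
  apply: lleU.
    rewrite {1}[x]half; apply: lleZ; first by rewrite invr_ge0.
    exact/lleD2r/lle_abs.
  apply: lscale_ge0; first by rewrite invr_ge0.
  by have := lleD2r x (lleN_abs x); rewrite addNr.
have := lleD2r (- x) (lleD h h).
rewrite -scalerDr -half addrK -addrA; congr (_ [<=] _); congr (_ + _).
by rewrite -{2}(lposBneg x) opprB addrC subrK.
Qed.

Lemma lnorm_pos x : `|lpos x| <= `|x|.
Proof.
rewrite -(lnorm_abs x); apply: lnorm_ge0_le; first exact: lpos_ge0.
by apply: lleU; [exact: lle_abs | exact: labs_ge0].
Qed.

Lemma lnorm_neg x : `|lneg x| <= `|x|.
Proof. by rewrite -(normrN x); exact: lnorm_pos. Qed.

Lemma lriesz x y z : 0 [<=] z -> 0 [<=] x -> 0 [<=] y -> z [<=] x + y ->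
  exists z1 z2, [/\ z = z1 + z2, 0 [<=] z1 /\ z1 [<=] x & 0 [<=] z2 /\ z2 [<=] y].
Proof.
move=> z0 x0 y0 zxy; exists (lmeet z x), (z - lmeet z x); split.
- by rewrite addrC subrK.
- by split; [exact: lleI | exact: lleIr].
- split; first by apply/lsub_ge0/lleIl.
  have h : z - y [<=] lmeet z x.
    apply: lleI; last by apply/lsub_ge0; rewrite opprB addrA; apply/lsub_ge0.
    by apply/lsub_ge0; rewrite opprB addrC subrK.
  have := lleD2r (y - lmeet z x) h.
  by rewrite addrA subrK [lmeet z x + _]addrC subrK.
Qed.

Lemma lcvg_ge0 (u : nat -> E) x :
  (forall n, 0 [<=] u n) -> u @ \oo --> x -> 0 [<=] x.
Proof.
move=> u0 ux; suff h : lneg x = 0 by rewrite -(lposBneg x) h subr0; exact: lpos_ge0.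
apply/eqP; rewrite -normr_le0; apply/ler_addgt0Pl => e e0; rewrite addr0.
have /cvgrPdist_lt /(_ _ e0) [n _ /(_ n (leqnn n)) un] := ux.
apply: le_trans (ltW un); rewrite distrC -(lnorm_abs (u n - x)).
apply: lnorm_ge0_le; first exact: lneg_ge0.
apply: lleU; last exact: labs_ge0.
apply: (lle_trans _ _ (lle_abs _)); apply/lsub_ge0.
by rewrite opprK subrK.
Qed.

End BanachLatticeTheory.
Section DualDef.
Context {R : realType} (E : normedModType R).

Definition dual_pred : {pred E -> R^o} :=
  fun f => `[< linear f /\ continuous f >].

Lemma dual_predP f : reflect (linear f /\ continuous f) (f \in dual_pred).
Proof. exact: asboolP. Qed.

Record dual := Dual { dual_fun :> E -> R^o; dual_funP : dual_fun \in dual_pred }.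

HB.instance Definition _ := [isSub for dual_fun].
HB.instance Definition _ := [Choice of dual by <:].

Lemma dual_submod_closed : submod_closed dual_pred.
Proof.
split=> [|a f g].
  apply/dual_predP; split=> [a x y|]; first by rewrite /= scaler0 addr0.
  exact: cst_continuous.
move=> /dual_predP[fl fc] /dual_predP[gl gc]; apply/dual_predP; split.
  move=> b x y; rewrite !fctE fl gl !scalerDr !scalerA [a * b]mulrC !addrA.
  by congr (_ + _); rewrite -!addrA; congr (_ + _); rewrite addrC.
move=> x; apply: cvgD; last exact: gc.
by apply: cvgZr; exact: fc.
Qed.

HB.instance Definition _ :=
  GRing.isSubmodClosed.Build R (E -> R^o) dual_pred dual_submod_closed.
HB.instance Definition _ := [SubChoice_isSubLmodule of dual by <:].

Lemma dual_linear (f : dual) : linear f.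
Proof. by have /dual_predP[] := dual_funP f. Qed.

HB.instance Definition _ (f : dual) :=
  GRing.isLinear.Build R E R^o *:%R f (dual_linear f).

Lemma dual_continuous (f : dual) : continuous f.
Proof. by have /dual_predP[] := dual_funP f. Qed.

Lemma dualP (f g : dual) : f =1 g -> f = g.
Proof. by move=> h; apply/val_inj/funext. Qed.

Lemma dualDE (f g : dual) x : (f + g) x = f x + g x. Proof. by []. Qed.
Lemma dualZE a (f : dual) x : (a *: f) x = a * f x. Proof. by []. Qed.
Lemma dualNE (f : dual) x : (- f) x = - f x. Proof. by []. Qed.
Lemma dual0E x : (0 : dual) x = 0. Proof. by []. Qed.
Lemma dualBE (f g : dual) x : (f - g) x = f x - g x. Proof. by []. Qed.

Definition dual_norm (f : dual) : R :=
  sup [set `|f x| | x in [set x : E | `|x| <= 1]].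

Lemma dual_bounded (f : dual) :
  exists2 M : R, 0 < M & forall x, `|f x| <= M * `|x|.
Proof.
have /linear_bounded_continuous/linear_boundedP : continuous f.
  exact: dual_continuous.
by move=> /pinfty_ex_gt0[M M0 h]; exists M.
Qed.

Lemma dual_norm_has_sup (f : dual) :
  has_sup [set `|f x| | x in [set x : E | `|x| <= 1]].
Proof.
split; first by exists `|f 0|, 0 => //=; rewrite normr0.
have [M M0 h] := dual_bounded f; exists M => _ [x /= x1 <-].
by apply: le_trans (h x) _; rewrite ler_piMr// ltW.
Qed.

Lemma dual_norm_ge0 f : 0 <= dual_norm f.
Proof.
apply: (@le_trans _ _ `|f 0|) => //; apply: ub_le_sup.
  by have [] := dual_norm_has_sup f.
by exists 0 => //=; rewrite normr0.
Qed.

Lemma dual_norm_ub (f : dual) x : `|f x| <= dual_norm f * `|x|.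
Proof.
have [->|x0] := eqVneq x 0; first by rewrite linear0 !normr0 mulr0.
have nx0 : 0 < `|x| by rewrite normr_gt0.
rewrite -ler_pdivrMr//; have -> : `|f x| / `|x| = `|f (`|x|^-1 *: x)|.
  by rewrite linearZ/= normrM normfV normr_id mulrC.
apply: ub_le_sup; first by have [] := dual_norm_has_sup f.
exists (`|x|^-1 *: x) => //=.
by rewrite normrZ normfV normr_id mulVf// gt_eqF.
Qed.

Lemma dual_norm_le (f : dual) M :
  0 <= M -> (forall x, `|f x| <= M * `|x|) -> dual_norm f <= M.
Proof.
move=> M0 h; apply: ge_sup; first by have [] := dual_norm_has_sup f.
by move=> _ [x /= x1 <-]; apply: le_trans (h x) _; rewrite ler_piMr.
Qed.

Lemma dual_normD f g : dual_norm (f + g) <= dual_norm f + dual_norm g.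
Proof.
apply: dual_norm_le => [|x]; first by rewrite addr_ge0// dual_norm_ge0.
rewrite dualDE (le_trans (ler_normD _ _))// mulrDl.
by rewrite lerD// dual_norm_ub.
Qed.

Lemma dual_normZ_le a f : dual_norm (a *: f) <= `|a| * dual_norm f.
Proof.
apply: dual_norm_le => [|x]; first by rewrite mulr_ge0// dual_norm_ge0.
by rewrite dualZE normrM -mulrA ler_wpM2l// dual_norm_ub.
Qed.

Lemma dual_normZ a f : dual_norm (a *: f) = `|a| * dual_norm f.
Proof.
apply/eqP; rewrite eq_le dual_normZ_le/=.
have [->|a0] := eqVneq a 0; first by rewrite normr0 mul0r dual_norm_ge0.
rewrite -ler_pdivlMl ?normr_gt0// -normfV.
by apply: le_trans (dual_normZ_le _ _); rewrite scalerA mulVf// scale1r.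
Qed.

Lemma dual_norm0_eq0 f : dual_norm f = 0 -> f = 0.
Proof.
move=> f0; apply: dualP => x; apply/eqP; rewrite -normr_le0.
by have := dual_norm_ub f x; rewrite f0 mul0r.
Qed.

HB.instance Definition _ :=
  Lmodule_isNormed.Build R dual dual_normD dual_normZ dual_norm0_eq0.

Lemma dual_normE (f : dual) : `|f| = dual_norm f. Proof. by []. Qed.

Lemma ler_dual (f : dual) x : `|f x| <= `|f| * `|x|.
Proof. exact: dual_norm_ub. Qed.

Lemma dual_bound_subproof (f : E -> R^o) :
  linear f -> (exists M, forall x, `|f x| <= M * `|x|) -> f \in dual_pred.
Proof.
move=> fl [M h]; apply/dual_predP; split=> //.
pose fL : {linear E -> R^o} := HB.pack f (GRing.isLinear.Build _ _ _ _ f fl).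
have /linear_bounded_continuous : bounded_near fL (nbhs 0); last by [].
apply/linear_boundedP; near=> r => x.
apply: le_trans (h x) _; rewrite ler_wpM2r//.
Unshelve.
all: by end_near.
Qed.

Definition mk_dual (f : E -> R^o) (fl : linear f)
  (fb : exists M, forall x, `|f x| <= M * `|x|) : dual :=
  Dual (dual_bound_subproof fl fb).

Lemma dual_complete (F : set_system dual) : ProperFilter F -> cauchy F -> cvg F.
Proof.
move=> FF /cauchy_ballP Fc.
have Fcx e : 0 < e -> exists2 f0 : dual, True & F [set f | `|f0 - f| < e].
  move=> e0; have /cauchy_ballP/cauchyP/(_ e e0)[f0 h] := Fc.
  by exists f0 => //; apply: filterS h => f; rewrite -ball_normE.
have cx x : cvg ((fun f : dual => f x : R) @ F).
  apply: cauchy_cvg; apply/cauchyP => e e0.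
  have ex0 : 0 < `|x| + 1 by rewrite ltr_wpDl.
  have [|f0 _ h] := Fcx (e / (`|x| + 1)); first by rewrite divr_gt0.
  exists (f0 x); rewrite /fmap/=; apply: filterS h => f /= h.
  rewrite -[ball _ _ _]/(_ (_ < _)) -dualBE (le_lt_trans (ler_dual _ _))//.
  rewrite (@le_lt_trans _ _ (`|f0 - f| * (`|x| + 1)))//.
    by rewrite ler_wpM2l// lerDl.
  by rewrite -ltr_pdivlMr.
pose g x : R^o := lim ((fun f : dual => f x : R) @ F).
have gc x : (fun f : dual => f x : R) @ F --> g x by exact: cx.
have gl : linear g.
  move=> a x y; apply: (@cvg_lim R) => //.
  rewrite (_ : (fun f : dual => _) = (fun f : dual => a * f x + f y)); last first.
    by apply/funext => f; rewrite linearP.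
  by apply: cvgD; [apply: cvgMl_tmp; exact: gc | exact: gc].
have gb (f0 : dual) e : 0 < e -> F [set f | `|f0 - f| < e] ->
    forall x, `|f0 x - g x| <= e * `|x|.
  move=> e0 h x.
  have hc : (fun f : dual => `|f0 x - f x| : R) @ F --> `|f0 x - g x|.
    by apply: cvg_norm; apply: cvgB; [exact: cvg_cst | exact: gc].
  apply: (closed_cvg (fun z : R => z <= e * `|x|) _ _ _ hc).
    exact: closed_le.
  apply: filterS h => f /= h; rewrite -dualBE (le_trans (ler_dual _ _))//.
  by rewrite ler_wpM2r// ltW.
have [f1 _ h1] := Fcx 1 ltr01.
have gbd : exists M, forall x, `|g x| <= M * `|x|.
  exists (`|f1| + 1) => x; rewrite -(subrK (f1 x) (g x)) addrC.
  rewrite (le_trans (ler_normD _ _))// mulrDl lerD ?ler_dual//.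
  by rewrite distrC; exact: gb.
apply/cvg_ex; exists (mk_dual gl gbd); apply/cvgrPdist_le => e e0.
have e20 : 0 < e / 2 by rewrite divr_gt0.
have [f0 _ h0] := Fcx _ e20.
have hg : `|f0 - mk_dual gl gbd| <= e / 2.
  by apply: dual_norm_le => [|x]; [exact: ltW | exact: gb].
apply: filterS h0 => f /= h.
rewrite -(subrK f0 (mk_dual gl gbd)) -addrA (le_trans (ler_normD _ _))//.
by rewrite [leRHS](splitr e) lerD//; [rewrite distrC | exact: ltW].
Qed.

HB.instance Definition _ := Uniform_isComplete.Build dual dual_complete.

End DualDef.
Section DualLattice.
Context {R : realType} {E : banachLatticeType R}.
Implicit Types (f g h : dual E) (x y : E).

Definition dual_le f g : Prop := forall x, 0 [<=] x -> f x <= g x.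

Let seg x := [set y : E | 0 [<=] y /\ y [<=] x].

Let ppos f x : R := sup [set f y | y in seg x].

Let seg_norm x y : seg x y -> `|y| <= `|x|.
Proof. by move=> [y0 yx]; exact: lnorm_ge0_le. Qed.

Let ppos_sup f x : 0 [<=] x -> has_sup [set f y | y in seg x].
Proof.
move=> x0; split; first by exists (f x), x => //; split=> //; exact: llexx.
exists (`|f| * `|x|) => _ [y xy <-].
by rewrite (le_trans (ler_norm _))// (le_trans (ler_dual _ _))// ler_wpM2l// seg_norm.
Qed.

Let ppos_ub f x y : 0 [<=] x -> seg x y -> f y <= ppos f x.
Proof. by move=> x0 xy; apply: ub_le_sup; [exact: (ppos_sup f x0).2 | exists y]. Qed.

Let ppos_le f x M : 0 [<=] x -> (forall y, seg x y -> f y <= M) -> ppos f x <= M.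
Proof.
move=> x0 h; apply: ge_sup; first exact: (ppos_sup f x0).1.
by move=> _ [y xy <-]; exact: h.
Qed.

Let ppos_ge0 f x : 0 [<=] x -> 0 <= ppos f x.
Proof.
move=> x0; rewrite -[X in X <= _](linear0 f); apply: ppos_ub => //.
by split=> //; exact: llexx.
Qed.

Let ppos_norm f x : 0 [<=] x -> ppos f x <= `|f| * `|x|.
Proof.
move=> x0; apply: ppos_le => // y xy.
by rewrite (le_trans (ler_norm _))// (le_trans (ler_dual _ _))// ler_wpM2l// seg_norm.
Qed.

Let pposD f x y : 0 [<=] x -> 0 [<=] y -> ppos f (x + y) = ppos f x + ppos f y.
Proof.
move=> x0 y0; have xy0 := laddr_ge0 x0 y0; apply/eqP; rewrite eq_le; apply/andP; split.
  apply: ppos_le => // z [z0 zxy].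
  have [z1 [z2 [-> h1 h2]]] := lriesz z0 x0 y0 zxy.
  by rewrite linearD lerD// ppos_ub.
rewrite -lerBrDr; apply: ppos_le => // z [z0 zx].
rewrite lerBrDr addrC -lerBrDr; apply: ppos_le => // t [t0 ty].
rewrite lerBrDr; have -> : f t + f z = f (z + t) by rewrite linearD addrC.
by apply: ppos_ub => //; split; [exact: laddr_ge0 | exact: lleD].
Qed.

Let pposZ_le f a x : 0 < a -> 0 [<=] x -> a * ppos f x <= ppos f (a *: x).
Proof.
move=> a0 x0; have ax0 := lscale_ge0 (ltW a0) x0.
rewrite -ler_pdivlMl//; apply: ppos_le => // y [y0 yx].
have -> : f y = a^-1 * f (a *: y).
  by rewrite linearZ/= mulrA mulVf ?mul1r// gt_eqF.
apply: ler_wpM2l; first by rewrite invr_ge0 ltW.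
apply: ppos_ub => //.
by split; [exact: lscale_ge0 (ltW a0) y0 | exact: lleZ (ltW a0) yx].
Qed.

Let pposZ f a x : 0 <= a -> 0 [<=] x -> ppos f (a *: x) = a * ppos f x.
Proof.
rewrite le_eqVlt => /predU1P[<- x0|a0 x0].
  rewrite scale0r mul0r; apply/eqP; rewrite eq_le ppos_ge0 ?andbT//; last exact: llexx.
  by have := ppos_norm f (llexx (0 : E)); rewrite normr0 mulr0.
apply/eqP; rewrite eq_le pposZ_le// andbT.
have ax0 := lscale_ge0 (ltW a0) x0.
have := @pposZ_le f a^-1 (a *: x); rewrite invr_gt0 => /(_ a0 ax0).
by rewrite scalerA mulVf ?gt_eqF// scale1r ler_pdivrMl.
Qed.

Let dpos_fun f x : R^o := ppos f (lpos x) - ppos f (lneg x).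

Let dpos_funB f x y : 0 [<=] x -> 0 [<=] y -> dpos_fun f (x - y) = ppos f x - ppos f y.
Proof.
move=> x0 y0; have := lposBneg (x - y).
set u := lpos _; set v := lneg _ => h.
have u0 : 0 [<=] u by exact: lpos_ge0.
have v0 : 0 [<=] v by exact: lneg_ge0.
have e : u + y = x + v.
  by apply/eqP; rewrite -subr_eq addrAC h subrK.
have : ppos f (u + y) = ppos f (x + v) by rewrite e.
rewrite !pposD// /dpos_fun -/u -/v => q; apply/eqP.
by rewrite subr_eq addrAC eq_sym subr_eq q.
Qed.

Let dpos_linear f : linear (dpos_fun f).
Proof.
have dD x y : dpos_fun f (x + y) = dpos_fun f x + dpos_fun f y.
  rewrite -[in LHS](lposBneg x) -[in LHS](lposBneg y) addrACA -opprD.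
  have [? ?] := (lpos_ge0 x, lneg_ge0 x); have [? ?] := (lpos_ge0 y, lneg_ge0 y).
  rewrite dpos_funB; [|exact: laddr_ge0|exact: laddr_ge0].
  by rewrite !pposD// opprD addrACA.
have dN x : dpos_fun f (- x) = - dpos_fun f x.
  rewrite -[in LHS](lposBneg x) opprB dpos_funB ?opprB//.
    exact: lneg_ge0.
  exact: lpos_ge0.
have dZ a x : 0 <= a -> dpos_fun f (a *: x) = a * dpos_fun f x.
  move=> a0; have [? ?] := (lpos_ge0 x, lneg_ge0 x).
  rewrite -[in LHS](lposBneg x) scalerBr dpos_funB; [|exact: lscale_ge0|exact: lscale_ge0].
  by rewrite !pposZ// mulrBr.
move=> a x y; rewrite dD; congr (_ + _).
have [a0|a0] := leP 0 a; first by rewrite dZ.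
by rewrite -[a]opprK scaleNr dN dZ ?oppr_ge0 ?ltW// scaleNr.
Qed.

Let dpos_bounded f : exists M, forall x, `|dpos_fun f x| <= M * `|x|.
Proof.
exists (`|f| + `|f|) => x; rewrite (le_trans (ler_normB _ _))// mulrDl.
rewrite !ger0_norm ?ppos_ge0//; [|exact: lneg_ge0|exact: lpos_ge0].
apply: lerD.
  rewrite (le_trans (ppos_norm _ (lpos_ge0 _)))// ler_wpM2l//; exact: lnorm_pos.
rewrite (le_trans (ppos_norm _ (lneg_ge0 _)))// ler_wpM2l//; exact: lnorm_neg.
Qed.

(* The positive part, by the Riesz-Kantorovich formula (see dual_posE). *)
Definition dual_pos f : dual E := mk_dual (dpos_linear f) (dpos_bounded f).

Lemma dual_posE f x : 0 [<=] x ->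
  dual_pos f x = sup [set f y | y in [set y : E | 0 [<=] y /\ y [<=] x]].
Proof.
move=> x0; have := dpos_funB f x0 (llexx (0 : E)).
have -> : ppos f 0 = 0 by rewrite -(scale0r (0 : E)) pposZ ?mul0r//; exact: llexx.
by rewrite !subr0.
Qed.

Definition dual_join f g := dual_pos (f - g) + g.
Definition dual_meet f g := - dual_join (- f) (- g).

Lemma dual_lexx f : dual_le f f. Proof. by move=> x _; exact: lexx. Qed.

Lemma dual_le_anti f g : dual_le f g -> dual_le g f -> f = g.
Proof.
move=> fg gf; have h x : 0 [<=] x -> f x = g x.
  by move=> x0; apply/eqP; rewrite eq_le fg// gf.
apply: dualP => x; rewrite -(lposBneg x) !linearB /=.
by rewrite !h//; [exact: lneg_ge0|exact: lpos_ge0].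
Qed.

Lemma dual_le_trans g f h : dual_le f g -> dual_le g h -> dual_le f h.
Proof. by move=> fg gh x x0; rewrite (le_trans (fg x x0))// gh. Qed.

Lemma dual_leUl f g : dual_le f (dual_join f g).
Proof.
move=> x x0; rewrite dualDE -lerBlDr -dualBE dual_posE//; apply: ppos_ub => //.
by split=> //; exact: llexx.
Qed.

Lemma dual_leUr f g : dual_le g (dual_join f g).
Proof. by move=> x x0; rewrite dualDE lerDr dual_posE//; exact: ppos_ge0. Qed.

Lemma dual_leU f g h : dual_le f h -> dual_le g h -> dual_le (dual_join f g) h.
Proof.
move=> fh gh x x0; rewrite dualDE -lerBrDr dual_posE//; apply: ppos_le => // y [y0 yx].
rewrite dualBE (@le_trans _ _ (h y - g y))//; first by rewrite lerB// fh.
have := gh (x - y) ((lsub_ge0 y x).2 yx); rewrite !linearB/=.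
by rewrite lerBrDr -lerBrDl opprB addrA addrAC -lerBlDr.
Qed.

Lemma dual_leN f g : dual_le f g -> dual_le (- g) (- f).
Proof. by move=> fg x x0; rewrite !dualNE lerN2 fg. Qed.

Lemma dual_leIl f g : dual_le (dual_meet f g) f.
Proof. by rewrite -[X in dual_le _ X]opprK; apply/dual_leN/dual_leUl. Qed.

Lemma dual_leIr f g : dual_le (dual_meet f g) g.
Proof. by rewrite -[X in dual_le _ X]opprK; apply/dual_leN/dual_leUr. Qed.

Lemma dual_leI f g h : dual_le h f -> dual_le h g -> dual_le h (dual_meet f g).
Proof.
move=> hf hg; rewrite -[h]opprK; apply/dual_leN/dual_leU; exact: dual_leN.
Qed.

Lemma dual_leD2r h f g : dual_le f g -> dual_le (f + h) (g + h).
Proof. by move=> fg x x0; rewrite !dualDE lerD2r fg. Qed.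

Lemma dual_scale_ge0 (a : R) f : 0 <= a -> dual_le 0 f -> dual_le 0 (a *: f).
Proof. by move=> a0 f0 x x0; rewrite dualZE mulr_ge0//; exact: f0. Qed.

Lemma dual_le_norm f g :
  dual_le (dual_join f (- f)) (dual_join g (- g)) -> `|f| <= `|g|.
Proof.
move=> fg; apply: dual_norm_le => // x.
have f_le : `|f x| <= dual_join f (- f) (labs x).
  have := dual_leUl f (- f) (labs_ge0 x); have := dual_leUr f (- f) (labs_ge0 x).
  set m := dual_join _ _; rewrite dualNE => h1 h2.
  have m0 y : 0 [<=] y -> 0 <= m y.
    move=> y0; have := lerD (dual_leUl f (- f) y0) (dual_leUr f (- f) y0).
    by rewrite dualNE subrr -mulr2n pmulrn_lge0.
  have fm y : 0 [<=] y -> `|f y| <= m y.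
    by move=> y0; rewrite ler_norml lerNl -dualNE dual_leUr// dual_leUl.
  rewrite labsE -{1}(lposBneg x) linearB linearD/=.
  rewrite (le_trans (ler_normB _ _))// lerD// fm//; [exact: lpos_ge0|exact: lneg_ge0].
apply: (le_trans f_le); apply: (le_trans (fg _ (labs_ge0 x))).
rewrite dualDE dualNE -lerBrDr opprK dual_posE; last exact: labs_ge0.
apply: ppos_le => [|y [y0 yx]]; first exact: labs_ge0.
rewrite opprK dualDE -lerBlDr -linearD -linearB/= (le_trans (ler_norm _))//.
rewrite (le_trans (ler_dual _ _))// ler_wpM2l// -(lnorm_abs x); apply: lnorm_le.
apply: labs_le.
  apply/lsub_ge0; rewrite opprB addrA opprD addrACA.
  by apply: laddr_ge0; apply/lsub_ge0.
by apply/lsub_ge0; rewrite opprK addrC subrK; exact: laddr_ge0.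
Qed.

HB.instance Definition _ := isBanachLattice.Build R (dual E)
  dual_lexx dual_le_anti dual_le_trans dual_leUl dual_leUr dual_leU
  dual_leIl dual_leIr dual_leI dual_leD2r dual_scale_ge0 dual_le_norm.

End DualLattice.

Lemma dual_lleP (R : realType) (E : banachLatticeType R) (f g : dual E) :
  f [<=] g <-> forall x : E, 0 [<=] x -> f x <= g x.
Proof. by []. Qed.

Section Operators.
Context {R : realType}.

Definition bounded_bilinear (E1 E2 F : normedModType R) (A : E1 -> E2 -> F) :=
  exists M : R, forall x y, `|A x y| <= M * `|x| * `|y|.

Definition positive_bilinear (E1 E2 F : banachLatticeType R)
    (A : {bilinear E1 -> E2 -> F}) :=
  forall x y, 0 [<=] x -> 0 [<=] y -> 0 [<=] A x y.

Lemma dyadic_dominated (E : banachLatticeType R) (x : nat -> E) :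
  (forall n, 0 [<=] x n) -> (forall n, `|x n| <= 1) ->
  exists2 s : E, 0 [<=] s & forall n, (2^-1 ^+ n : R) *: x n [<=] s.
Proof.
move=> x0 x1; pose u n : E := (2^-1 ^+ n : R) *: x n.
have u0 n : 0 [<=] u n by apply: lscale_ge0 => //; rewrite exprn_ge0// invr_ge0.
have s0 n : 0 [<=] series u n.
  rewrite /series/=; elim: n => [|n ih]; first by rewrite big_geq//; exact: llexx.
  by rewrite big_nat_recr//=; exact: laddr_ge0.
have cu : cvg (series u @ \oo).
  apply: normed_cvg; apply: (@series_le_cvg _ _ (geometric 1 (2^-1))) => [n|n|n|].
  - exact: normr_ge0.
  - by rewrite /geometric/= mul1r exprn_ge0// invr_ge0.
  - rewrite /geometric/= mul1r normrZ ger0_norm ?exprn_ge0 ?invr_ge0//.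
    by rewrite ler_piMr// exprn_ge0// invr_ge0.
  - apply: is_cvg_geometric_series; rewrite ger0_norm ?invr_ge0//.
    by rewrite invf_lt1// ltr1n.
exists (lim (series u @ \oo)); first exact: lcvg_ge0 s0 cu.
move=> k; apply/lsub_ge0.
apply: (@lcvg_ge0 _ _ (fun n => series u (n + k.+1)%N - u k)).
  elim=> [|n ih]; first by rewrite add0n seriesSr addrK.
  by rewrite addSn seriesSr addrAC; exact: laddr_ge0.
by apply: cvgB; [rewrite (cvg_shiftn k.+1 (series u)) | exact: cvg_cst].
Qed.

(* Positive bilinear operators are automatically continuous; this is what makes
   their Aron-Berner extensions well defined. *)
Lemma positive_bilinear_bounded (E1 E2 F : banachLatticeType R)
  (A : {bilinear E1 -> E2 -> F}) : positive_bilinear A -> bounded_bilinear A.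
Proof.
move=> A0.
have A_le a s b t : 0 [<=] a -> a [<=] s -> 0 [<=] b -> b [<=] t -> A a b [<=] A s t.
  move=> a0 as_ b0 bt; apply/lsub_ge0.
  have -> : A s t - A a b = A (s - a) t + A a (t - b).
    by rewrite linearBl linearBr addrA subrK.
  by apply: laddr_ge0; apply: A0 => //; [apply/lsub_ge0|exact: lle_trans b0 bt|apply/lsub_ge0].
have [M hM] : exists M : R, forall x y, 0 [<=] x -> 0 [<=] y ->
    `|x| <= 1 -> `|y| <= 1 -> `|A x y| <= M.
  apply: contrapT => /forallNP nM.
  have /choice[z hz] (n : nat) : exists z : E1 * E2,
      [/\ 0 [<=] z.1, 0 [<=] z.2, `|z.1| <= 1, `|z.2| <= 1 &
          n%:R * 2 ^+ n * 2 ^+ n < `|A z.1 z.2| ].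
    apply: contrapT => /forallNP nz; apply: (nM (n%:R * 2 ^+ n * 2 ^+ n)) => x y x0 y0 x1 y1.
    by rewrite leNgt; apply/negP => h; apply: (nz (x, y)).
  have [s s0 hs] := @dyadic_dominated E1 (fun n => (z n).1)
    (fun n => let: And5 h _ _ _ _ := hz n in h) (fun n => let: And5 _ _ h _ _ := hz n in h).
  have [t t0 ht] := @dyadic_dominated E2 (fun n => (z n).2)
    (fun n => let: And5 _ h _ _ _ := hz n in h) (fun n => let: And5 _ _ _ h _ := hz n in h).
  pose n := Num.bound `|A s t|; have := archi_boundP (normr_ge0 (A s t)).
  rewrite -/n; apply/negP; rewrite -leNgt.
  have [z1 z2 _ _ /ltW hn] := hz n.
  have p0 : 0 <= (2^-1 : R) ^+ n by rewrite exprn_ge0// invr_ge0.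
  have a0 := lscale_ge0 p0 z1; have b0 := lscale_ge0 p0 z2.
  have := lnorm_ge0_le (A0 _ _ a0 b0) (A_le _ _ _ _ a0 (hs n) b0 (ht n)).
  apply: le_trans; rewrite linearZl_LR linearZr_LR/= !normrZ !(ger0_norm p0).
  have q0 : 0 < (2 : R) ^+ n by rewrite exprn_gt0.
  by rewrite exprVn ler_pdivlMl// ler_pdivlMl// mulrC [_ * n%:R]mulrC.
have M0 : 0 <= M.
  by apply: le_trans (hM 0 0 (llexx _) (llexx _) _ _); rewrite ?normr0.
have hp x y : 0 [<=] x -> 0 [<=] y -> `|A x y| <= M * `|x| * `|y|.
  move=> x0 y0; have [->|xn0] := eqVneq x 0.
    by rewrite linear0l !normr0 mulr0 mul0r.
  have [->|yn0] := eqVneq y 0; first by rewrite linear0r !normr0 mulr0.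
  have nx0 : 0 < `|x| by rewrite normr_gt0.
  have ny0 : 0 < `|y| by rewrite normr_gt0.
  have := hM (`|x|^-1 *: x) (`|y|^-1 *: y).
  rewrite !normrZ !normfV !normr_id !mulVf ?gt_eqF// => /(_ _ _ (lexx _) (lexx _)).
  rewrite linearZl_LR linearZr_LR/= !normrZ !normfV !normr_id.
  rewrite ler_pdivrMl// ler_pdivrMl// [`|y| * _]mulrC [`|x| * M]mulrC; apply.
    by apply: lscale_ge0 => //; rewrite invr_ge0.
  by apply: lscale_ge0 => //; rewrite invr_ge0.
exists (M *+ 4) => x y.
have hq x' y' : 0 [<=] x' -> 0 [<=] y' -> `|x'| <= `|x| -> `|y'| <= `|y| ->
    `|A x' y'| <= M * `|x| * `|y|.
  move=> x0 y0 hx hy; apply: le_trans (hp _ _ x0 y0) _.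
  by apply: ler_pM => //; [exact: mulr_ge0 | exact: ler_wpM2l].
rewrite -{1}(lposBneg x) -{1}(lposBneg y) linearBl !linearBr.
have [? ?] := (lpos_ge0 x, lneg_ge0 x); have [? ?] := (lpos_ge0 y, lneg_ge0 y).
have [? ?] := (lnorm_pos x, lnorm_neg x); have [? ?] := (lnorm_pos y, lnorm_neg y).
rewrite !mulrnAl (_ : 4 = 2 + 2)%N// mulrnDr mulr2n.
by rewrite (le_trans (ler_normB _ _))// lerD// (le_trans (ler_normB _ _))// lerD// hq.
Qed.

End Operators.

Section Slices.
Context {R : realType} {E1 E2 F : normedModType R}.
Context {A : {bilinear E1 -> E2 -> F}} (Ab : bounded_bilinear A).

Let slice_bound : exists2 M : R, 0 <= M & forall (y : dual F) x1 x2,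
  `|y (A x1 x2)| <= M * `|y| * `|x1| * `|x2|.
Proof.
have [M hM] := Ab; exists `|M| => // y x1 x2.
apply: le_trans (ler_dual _ _) _; rewrite [`|M| * _]mulrC -!mulrA ler_wpM2l//.
by apply: le_trans (hM _ _) _; rewrite -mulrA ler_wpM2r ?mulr_ge0// ler_norm.
Qed.

Let slice1_linear (y : dual F) x2 : linear (fun x1 => y (A x1 x2) : R^o).
Proof. by move=> a u v; rewrite linearPl linearP. Qed.

Let slice1_bounded (y : dual F) x2 :
  exists M, forall x1, `|y (A x1 x2)| <= M * `|x1|.
Proof.
have [M _ hM] := slice_bound; exists (M * `|y| * `|x2|) => x1.
by rewrite mulrAC; exact: hM.
Qed.

Definition slice1 y x2 : dual E1 :=
  mk_dual (slice1_linear y x2) (slice1_bounded y x2).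

Let slice2_linear (y : dual F) x1 : linear (fun x2 => y (A x1 x2) : R^o).
Proof. by move=> a u v; rewrite linearPr linearP. Qed.

Let slice2_bounded (y : dual F) x1 :
  exists M, forall x2, `|y (A x1 x2)| <= M * `|x2|.
Proof. by have [M _ hM] := slice_bound; exists (M * `|y| * `|x1|) => x2; exact: hM. Qed.

Definition slice2 y x1 : dual E2 :=
  mk_dual (slice2_linear y x1) (slice2_bounded y x1).

Let slice1_bilinear : bilinear_for *:%R *:%R slice1.
Proof.
by split=> [x2 a u v|y a u v]; apply: dualP => x1 //=; rewrite linearPr linearP.
Qed.

Let slice2_bilinear : bilinear_for *:%R *:%R slice2.
Proof.
by split=> [x1 a u v|y a u v]; apply: dualP => x2 //=; rewrite linearPl linearP.
Qed.

HB.instance Definition _ := bilinear_isBilinear.Build R (dual F) E2 (dual E1)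
  _ _ slice1 slice1_bilinear.
HB.instance Definition _ := bilinear_isBilinear.Build R (dual F) E1 (dual E2)
  _ _ slice2 slice2_bilinear.

Lemma slice1_bounded_bilinear : bounded_bilinear slice1.
Proof.
have [M M0 hM] := slice_bound; exists M => y x2.
apply: dual_norm_le => [|x1]; first by rewrite !mulr_ge0.
by rewrite mulrAC; exact: hM.
Qed.

Lemma slice2_bounded_bilinear : bounded_bilinear slice2.
Proof.
have [M M0 hM] := slice_bound; exists M => y x1.
by apply: dual_norm_le => [|x2]; [rewrite !mulr_ge0 | exact: hM].
Qed.

End Slices.

Section IteratedExtension.
Context {R : realType} {F G H : normedModType R}.
Context {phi : {bilinear dual F -> G -> dual H}} (phib : bounded_bilinear phi).
Implicit Types (z : dual (dual H)) (w : dual (dual G)) (y : dual F).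

Let phi_bound : exists2 M : R, 0 <= M & forall z y x,
  `|z (phi y x)| <= M * `|z| * `|y| * `|x|.
Proof.
have [M hM] := phib; exists `|M| => // z y x.
apply: le_trans (ler_dual _ _) _; rewrite [`|M| * _]mulrC -!mulrA ler_wpM2l//.
by apply: le_trans (hM _ _) _; rewrite -mulrA ler_wpM2r ?mulr_ge0// ler_norm.
Qed.

Let inner_linear z y : linear (fun x => z (phi y x) : R^o).
Proof. by move=> a u v; rewrite linearPr linearP. Qed.

Let inner_bounded z y : exists M, forall x, `|z (phi y x)| <= M * `|x|.
Proof. by have [M _ hM] := phi_bound; exists (M * `|z| * `|y|) => x; exact: hM. Qed.

Definition iter_inner z y : dual G :=
  mk_dual (inner_linear z y) (inner_bounded z y).

Let outer_linear z w : linear (fun y => w (iter_inner z y) : R^o).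
Proof.
move=> a u v.
transitivity (w (a *: iter_inner z u + iter_inner z v)); last exact: linearP.
congr (dual_fun w _).
by apply: dualP => x /=; rewrite linearPl linearP.
Qed.

Let outer_bounded z w : exists M, forall y, `|w (iter_inner z y)| <= M * `|y|.
Proof.
have [M M0 hM] := phi_bound; exists (`|w| * (M * `|z|)) => y.
apply: le_trans (ler_dual _ _) _; rewrite -mulrA ler_wpM2l//.
by apply: dual_norm_le => [|x]; [rewrite !mulr_ge0 | exact: hM].
Qed.

(* y |-> w (x |-> z (phi y x)) *)
Definition iter_ext z w : dual (dual F) :=
  mk_dual (outer_linear z w) (outer_bounded z w).

Lemma iter_ext_bilinear : bilinear_for *:%R *:%R iter_ext.
Proof.
split=> [w a u v|z a u v]; apply: dualP => y //=.
transitivity (w (a *: iter_inner u y + iter_inner v y)); last exact: linearP.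
by congr (dual_fun w _); apply: dualP.
Qed.

End IteratedExtension.

Section AronBerner.
Context {R : realType} {E1 E2 F : normedModType R}.
Context {A : {bilinear E1 -> E2 -> F}} (Ab : bounded_bilinear A).

Definition aron_berner (rho : 'S_2) (z1 : dual (dual E1)) (z2 : dual (dual E2)) :
    dual (dual F) :=
  if rho == 1%g then iter_ext (slice1_bounded_bilinear Ab) z1 z2
  else iter_ext (slice2_bounded_bilinear Ab) z2 z1.

Let aron_berner_bilinear rho : bilinear_for *:%R *:%R (aron_berner rho).
Proof.
rewrite /aron_berner; case: (rho == 1%g).
  exact: iter_ext_bilinear.
by have [h k] := iter_ext_bilinear (slice2_bounded_bilinear Ab); split=> u.
Qed.

HB.instance Definition _ rho := bilinear_isBilinear.Build R
  (dual (dual E1)) (dual (dual E2)) (dual (dual F)) _ _ (aron_berner rho)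
  (aron_berner_bilinear rho).

Lemma slice1E (y : dual F) x2 x1 : slice1 Ab y x2 x1 = y (A x1 x2).
Proof. by []. Qed.

Lemma slice2E (y : dual F) x1 x2 : slice2 Ab y x1 x2 = y (A x1 x2).
Proof. by []. Qed.

Definition slice1_ext (z1 : dual (dual E1)) (y : dual F) : dual E2 :=
  iter_inner (slice1_bounded_bilinear Ab) z1 y.

Definition slice2_ext (z2 : dual (dual E2)) (y : dual F) : dual E1 :=
  iter_inner (slice2_bounded_bilinear Ab) z2 y.

Lemma slice1_extE z1 y x2 : slice1_ext z1 y x2 = z1 (slice1 Ab y x2).
Proof. by []. Qed.

Lemma slice2_extE z2 y x1 : slice2_ext z2 y x1 = z2 (slice2 Ab y x1).
Proof. by []. Qed.

Lemma aron_berner_idE z1 z2 y : aron_berner 1%g z1 z2 y = z2 (slice1_ext z1 y).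
Proof. by rewrite /aron_berner eqxx. Qed.

Lemma aron_berner_transpE rho z1 z2 y : rho != 1%g ->
  aron_berner rho z1 z2 y = z1 (slice2_ext z2 y).
Proof. by rewrite /aron_berner => /negbTE->. Qed.

End AronBerner.

Section Properties.
Context {R : realType}.

Definition norm_null (E : normedModType R) (u : nat -> E) := u @ \oo --> (0 : E).

Definition weakly_null (E : normedModType R) (u : nat -> E) :=
  forall f : dual E, (fun n => f (u n) : R) @ \oo --> (0 : R).

Definition weakstar_null (E : normedModType R) (f : nat -> dual E) :=
  forall x : E, (fun n => f n x : R) @ \oo --> (0 : R).

Definition positive_seq (E : banachLatticeType R) (u : nat -> E) :=
  forall n, 0 [<=] u n.

Definition disjoint_seq (E : banachLatticeType R) (u : nat -> E) :=
  forall n k, n != k -> lmeet (labs (u n)) (labs (u k)) = 0.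

Definition order_bounded_seq (E : banachLatticeType R) (u : nat -> E) :=
  exists a b : E, forall n, a [<=] u n /\ u n [<=] b.

Definition order_continuous_norm (E : banachLatticeType R) :=
  forall (I : Type) (leI : I -> I -> Prop) (x : I -> E),
    inhabited I ->
    (forall i, leI i i) ->
    (forall i j k, leI i j -> leI j k -> leI i k) ->
    (forall i j, exists k, leI i k /\ leI j k) ->
    (forall i j, leI i j -> x j [<=] x i) ->
    (forall i, 0 [<=] x i) ->
    (forall z, (forall i, z [<=] x i) -> z [<=] 0) ->
  forall e : R, 0 < e -> exists i, forall j, leI i j -> `|x j| < e.

Definition dual_positive_schur (E : banachLatticeType R) :=
  forall f : nat -> dual E,
    positive_seq f -> weakstar_null f -> norm_null f.

Definition almost_dunford_pettis (E1 E2 : banachLatticeType R)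
    (G : completeNormedModType R) (A : {bilinear E1 -> E2 -> G}) :=
  forall (u : nat -> E1) (v : nat -> E2),
    disjoint_seq u -> weakly_null u ->
    disjoint_seq v -> weakly_null v ->
    norm_null (fun n => A (u n) (v n)).

Definition weakly_positively_limited (X1 X2 : banachLatticeType R)
    (G : completeNormedModType R) (B : {bilinear dual X1 -> dual X2 -> G}) :=
  (forall (f : nat -> dual X1) (g : nat -> dual X2),
     positive_seq f -> weakstar_null f ->
     positive_seq g -> bounded_fun g ->
     norm_null (fun n => B (f n) (g n))) /\
  (forall (f : nat -> dual X1) (g : nat -> dual X2),
     positive_seq f -> bounded_fun f ->
     positive_seq g -> weakstar_null g ->
     norm_null (fun n => B (f n) (g n))).

End Properties.

Arguments order_continuous_norm {R} E.
Arguments dual_positive_schur {R} E.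

(* Main.v *)
(* The key tool is the Dodds-Fremlin criterion: a positive weak*-null sequence f_n
   in E^* is norm null as soon as f_(p n)(u_n) -> 0 for every increasing p and every
   positive disjoint sequence u in the unit ball of E.  Applied in F^*, it reduces
   norm nullity of the positive functionals AB(z_n, w_n) to weak*-nullity, by either
   alternative on F.  So fix y >= 0 in F^*, and let S x be the slice of y o A at x.
   Since disjoint bounded sequences of E_1 and E_2 are weakly null (the duals having
   order continuous norms), the criterion gives ||S v_n|| -> 0 for v disjoint in the
   ball.  If z_n is weak*-null, a second application gives ||z_n o S|| -> 0, hence
   w_n(z_n o S) -> 0 for bounded w_n.  If instead w_n is weak*-null, apply the
   criterion to the functionals z |-> w_n(z o S) on the bidual: disjoint bounded
   sequences of the bidual are weak*-null by order continuity of the norm of the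
   dual, so the previous case covers them. *)

Require Import Defs.
From mathcomp Require Import all_boot all_order all_algebra all_fingroup.
From mathcomp Require Import all_classical all_reals all_analysis.
From mathcomp Require Import lra.
Set Implicit Arguments.
Unset Strict Implicit.
Unset Printing Implicit Defensive.
Import Order.TTheory GRing.Theory Num.Theory.
Import numFieldNormedType.Exports.
Local Open Scope classical_set_scope.
Local Open Scope ring_scope.

(** * Null sequences and uniform boundedness *)

Section NullSequences.
Context {R : realType}.

Lemma cvg0_epsP (V : pseudoMetricNormedZmodType R) (u : nat -> V) :
  u @ \oo --> 0 <->
  forall e : R, 0 < e -> exists N, forall n, (N <= n)%N -> `|u n| <= e.
Proof.
split=> [/cvgr0Pnorm_le h e e0|h].
  by have [N _ hN] := h e e0; exists N => n; exact: hN.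
by apply/cvgr0Pnorm_le => e e0; have [N hN] := h e e0; exists N.
Qed.

Lemma cvg0_dominated (V W : pseudoMetricNormedZmodType R)
    (u : nat -> V) (v : nat -> W) (C : R) :
  (forall n, `|u n| <= C * `|v n|) -> v @ \oo --> 0 -> u @ \oo --> 0.
Proof.
move=> uv /cvg0_epsP h; apply/cvg0_epsP => e e0.
have D0 : 0 < `|C| + 1 by rewrite ltr_wpDl.
have [|N hN] := h (e / (`|C| + 1)); first by rewrite divr_gt0.
exists N => n /hN; rewrite ler_pdivlMr// => hn.
apply: le_trans (uv n) (le_trans _ hn); rewrite mulrC ler_wpM2l//.
by rewrite (le_trans (ler_norm C))// lerDl.
Qed.

Lemma cvg0_comp (V : pseudoMetricNormedZmodType R) (u : nat -> V)
    (phi : nat -> nat) :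
  {homo phi : i j / (i < j)%N} -> u @ \oo --> 0 -> (u \o phi) @ \oo --> 0.
Proof.
move=> phi_inc /cvg0_epsP h; apply/cvg0_epsP => e /h[N hN]; exists N => n Nn.
apply: hN; apply: leq_trans Nn _; elim: n => // n ih.
by apply: leq_ltn_trans ih _; exact: phi_inc.
Qed.

(** Banach-Steinhaus on the complete space [E]: convergence at each point bounds the functionals
    there, and the resulting bound on the unit ball becomes a norm bound by scaling. *)
Lemma weakstar_null_bounded (E : completeNormedModType R) (f : nat -> dual E) :
  weakstar_null f -> exists2 M : R, 0 < M & forall n, `|f n| <= M.
Proof.
move=> f0; pose S : set (E -> R^o) := [set (f n : E -> R^o) | n in setT].
have Sc g : S g -> bounded_fun_norm g /\ linear g.
  case=> n _ <-; split=> [r|]; last exact: dual_linear.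
  exists (`|f n| * r) => x xr; apply: le_trans (ler_dual _ _) _.
  by rewrite ler_wpM2l.
have Sp : pointwise_bounded S.
  move=> x; have := cvgP _ (f0 x) => /cvg_seq_bounded[M [_ hM]].
  by exists (M + 1) => g [n _ <-]; apply: (hM (M + 1)); rewrite ?ltrDl.
have [M hM] := Banach_Steinhauss Sc Sp 1; exists (`|M| + 1); first by rewrite ltr_wpDl.
move=> n; apply: dual_norm_le => [|x]; first by rewrite addr_ge0.
have [->|x0] := eqVneq x 0; first by rewrite linear0 !normr0 mulr0.
have nx : 0 < `|x| by rewrite normr_gt0.
have : `|f n (`|x|^-1 *: x)| <= M.
  by apply: hM; [exists n | rewrite normrZ normfV normr_id mulVf ?gt_eqF].
rewrite linearZ/= normrM normfV normr_id ler_pdivrMl// mulrC => /le_trans; apply.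
by rewrite ler_wpM2r// (le_trans (ler_norm M))// lerDl.
Qed.

End NullSequences.

(** * The canonical embedding into the bidual *)

Section DualEval.
Context {R : realType} {E : normedModType R}.

Let eval_linear (x : E) : linear (fun f : dual E => f x : R^o).
Proof. by []. Qed.

Let eval_bounded (x : E) : exists C, forall f : dual E, `|f x| <= C * `|f|.
Proof. by exists `|x| => f; rewrite mulrC ler_dual. Qed.

Definition dual_eval (x : E) : dual (dual E) :=
  mk_dual (eval_linear x) (eval_bounded x).

Lemma dual_eval_norm_le x : `|dual_eval x| <= `|x|.
Proof. by apply: dual_norm_le => // f; rewrite mulrC; exact: (ler_dual f x). Qed.

End DualEval.

(** * Order calculus in a Banach lattice and its dual *)

Section LatticeLemmas.
Context {R : realType} {E : banachLatticeType R}.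
Implicit Types (x y z d : E) (a c : R).

Lemma lleD_ge0 x y z : x [<=] z -> 0 [<=] y -> x [<=] z + y.
Proof. by move=> xz y0; have := lleD xz y0; rewrite addr0. Qed.

Lemma lleB_ge0 x y z : x [<=] z -> 0 [<=] y -> x - y [<=] z.
Proof. by move=> xz /lleN; rewrite oppr0 => y0; have := lleD xz y0; rewrite addr0. Qed.

Lemma ljoin_leD x y : 0 [<=] x -> 0 [<=] y -> ljoin x y [<=] x + y.
Proof.
move=> x0 y0; apply: lleU; first exact: lleD_ge0 (llexx _) y0.
by rewrite addrC; exact: lleD_ge0 (llexx _) x0.
Qed.

Lemma lpos_mono x y : x [<=] y -> lpos x [<=] lpos y.
Proof.
by move=> xy; apply: lleU; [exact: lle_trans xy (lleUl _ _)|exact: lpos_ge0].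
Qed.

Lemma lpos_le x y : x [<=] y -> 0 [<=] y -> lpos x [<=] y.
Proof. exact: lleU. Qed.

Lemma lposZ a x : 0 < a -> lpos (a *: x) = a *: lpos x.
Proof.
have h b z : 0 < b -> lpos (b *: z) [<=] b *: lpos z.
  move=> b0; apply: lpos_le; first by apply: lleZ (lleUl _ _); exact: ltW.
  by apply: lscale_ge0 (lpos_ge0 _); exact: ltW.
move=> a0; apply: lle_anti; first exact: h.
have a0' : 0 < a^-1 by rewrite invr_gt0.
have := lleZ (ltW a0) (h _ (a *: x) a0').
by rewrite !scalerA mulVf ?mulfV ?gt_eqF// !scale1r.
Qed.

Lemma lmeet_pos_neg d : lmeet (lpos d) (lneg d) = 0.
Proof.
apply: lle_anti; last by apply: lleI; [exact: lpos_ge0 | exact: lneg_ge0].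
set m := lmeet _ _.
(* As [m] is below both parts of [d], [lpos d - m] is a positive upper bound of [d]. *)
have : lpos d [<=] lpos d - m.
  apply: lpos_le; last by apply/lsub_ge0; exact: lleIl.
  rewrite -{1}(lposBneg d); have : m [<=] lneg d by exact: lleIr.
  by move=> /lleN h; have := lleD (llexx (lpos d)) h.
by move=> /lsub_ge0; rewrite addrAC subrr add0r => /lleN; rewrite opprK oppr0.
Qed.

Lemma lmeet_eq0_le x y x' y' : 0 [<=] x' -> 0 [<=] y' ->
  x' [<=] x -> y' [<=] y -> lmeet x y = 0 -> lmeet x' y' = 0.
Proof.
move=> x0 y0 xx yy xy; apply: lle_anti; last exact: lleI.
rewrite -xy; apply: lleI; first exact: lle_trans (lleIl _ _) xx.
exact: lle_trans (lleIr _ _) yy.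
Qed.

Lemma lmeetC x y : lmeet x y = lmeet y x.
Proof. by apply: lle_anti; apply: lleI; [exact: lleIr|exact: lleIl|exact: lleIr|exact: lleIl]. Qed.

(** The elements [y / (n + 1) - x] are positive and tend to [- x]; the positive cone is closed. *)
Lemma archimedean_le0 x y : (forall n, n%:R *: x [<=] y) -> x [<=] 0.
Proof.
move=> h; rewrite -(opprK x) -oppr0; apply: lleN.
apply: (@lcvg_ge0 _ _ (fun n => n.+1%:R^-1 *: y - x)) => [n|].
  apply/lsub_ge0; have n0 : 0 <= n.+1%:R^-1 :> R by rewrite invr_ge0.
  by have := lleZ n0 (h n.+1); rewrite scalerA mulVf ?scale1r ?pnatr_eq0.
rewrite -[X in _ --> X]add0r; apply: cvgB; last exact: cvg_cst.
by rewrite -(scale0r y); apply: cvgZr_tmp; exact: cvg_harmonic.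
Qed.

Lemma disjoint_labs (u : nat -> E) n k : positive_seq u -> disjoint_seq u ->
  n != k -> lmeet (u n) (u k) = 0.
Proof. by move=> u0 du nk; have := du _ _ nk; rewrite !labs_id. Qed.

Lemma positive_disjointP (u : nat -> E) : positive_seq u ->
  (forall n k, (n < k)%N -> lmeet (u n) (u k) = 0) -> disjoint_seq u.
Proof.
move=> u0 h n k; rewrite !labs_id//.
by rewrite neq_ltn => /orP[/h//|/h]; rewrite lmeetC.
Qed.

Lemma disjoint_lpos (u : nat -> E) : disjoint_seq u -> disjoint_seq (lpos \o u).
Proof.
move=> du n k /du nk; rewrite !labs_id; [|exact: lpos_ge0..].
by apply: lmeet_eq0_le nk; rewrite ?labsE; do ?[exact: lpos_ge0 |
  by apply: lleD_ge0 (llexx _) _; exact: lneg_ge0].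
Qed.

Lemma disjoint_lneg (u : nat -> E) : disjoint_seq u -> disjoint_seq (lneg \o u).
Proof.
move=> du n k /du nk; rewrite !labs_id; [|exact: lneg_ge0..].
by apply: lmeet_eq0_le nk; rewrite ?labsE; do ?[exact: lneg_ge0 |
  by rewrite addrC; apply: lleD_ge0 (llexx _) _; exact: lpos_ge0].
Qed.

Lemma dual_ge0 (f : dual E) x : 0 [<=] f -> 0 [<=] x -> 0 <= f x.
Proof. by move=> f0; exact: f0. Qed.

Lemma dual_mono (f : dual E) x y : 0 [<=] f -> x [<=] y -> f x <= f y.
Proof. by move=> f0 /lsub_ge0/(dual_ge0 f0); rewrite linearB/= subr_ge0. Qed.

Lemma dual_eval_ge0 x : 0 [<=] x -> 0 [<=] dual_eval x.
Proof. by move=> x0; apply/dual_lleP => f f0; exact: dual_ge0 f0 x0. Qed.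

Lemma dual_cvg0_ge0 (f : nat -> dual E) :
  (forall x, 0 [<=] x -> (fun n => f n x : R) @ \oo --> (0 : R)) ->
  weakstar_null f.
Proof.
move=> h x; rewrite -(lposBneg x) -(subrr (0 : R)).
rewrite (_ : (fun n => _) = (fun n => f n (lpos x) - f n (lneg x) : R)); last first.
  by apply/funext => n; rewrite linearB.
by apply: cvgB; apply: h; [exact: lpos_ge0 | exact: lneg_ge0].
Qed.

Lemma dual_le_norm_abs (f : dual E) x : 0 [<=] f -> `|f x| <= f (labs x).
Proof.
move=> f0; rewrite ler_norml; apply/andP; split; last exact/dual_mono/lle_abs.
by rewrite lerNl -linearN; exact/dual_mono/lleN_abs.
Qed.

End LatticeLemmas.

(** * Order continuous norms and sequences of functionals that can be split *)

Section OrderContinuity.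
Context {R : realType} {X : banachLatticeType R}.
Hypothesis oc : order_continuous_norm X.

(* No order completeness is assumed, so the infimum of [a] need not exist: the
   net to which order continuity applies is indexed by pairs of a position and a
   lower bound [z] of [a], its terms being [a k - z]. *)
Lemma oc_decreasing_cauchy (a : nat -> X) : (forall n, 0 [<=] a n) ->
  (forall n, a n.+1 [<=] a n) ->
  forall e : R, 0 < e -> exists k, forall j, (k <= j)%N -> `|a k - a j| <= e.
Proof.
move=> a0 aS e e0.
have a_dec i j : (i <= j)%N -> a j [<=] a i.
  move=> /subnK<-; elim: (j - i)%N => [|m ih]; first exact: llexx.
  by rewrite addSn; exact: lle_trans (aS _) ih.
pose L := {z : X | forall n, z [<=] a n}.
pose leI (p q : nat * L) := (p.1 <= q.1)%N /\ sval p.2 [<=] sval q.2.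
have l0 : forall n, 0 [<=] a n by [].
have [| | | | | | |[k [z hz]] hk] := @oc (nat * L)%type leI
    (fun p => a p.1 - sval p.2) _ _ _ _ _ _ _ e e0.
- by constructor; exact: (0%N, exist _ 0 l0).
- by move=> i; split=> //; exact: llexx.
- by move=> i j k [h1 h2] [h3 h4]; split; [exact: leq_trans h1 h3|exact: lle_trans h2 h4].
- move=> [i [u hu]] [j [v hv]].
  have huv n : ljoin u v [<=] a n by exact: lleU.
  exists (maxn i j, exist _ _ huv); split; split=> /=;
    rewrite ?leq_maxl ?leq_maxr//; [exact: lleUl|exact: lleUr].
- by move=> i j [h1 h2]; apply: lleD; [exact: a_dec|exact: lleN].
- by move=> [i [u hu]]; apply/lsub_ge0.
(* A lower bound [w] of the net can be added to any lower bound of [a] and gives another one.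
   Starting from 0, every [n w] is a lower bound of [a], so [w] is at most 0 by the Archimedean
   property. *)
- move=> w hw; suff h n : forall i, n%:R *: w [<=] a i.
    by apply: (@archimedean_le0 _ _ _ (a 0%N)) => n; exact: h.
  elim: n => [|n ih] i; first by rewrite scale0r.
  have := hw (i, exist _ _ ih) => /= /(lleD2r (n%:R *: w)).
  by rewrite subrK -[n.+1]addn1 natrD scalerDl scale1r addrC.
(* With [z] fixed, [a k - a j] lies between 0 and [a k - z] for every later [j]. *)
have /ltW hkk := hk (k, exist _ z hz) (conj (leqnn k) (llexx z)).
exists k => j kj; apply: le_trans _ hkk => /=.
apply: lnorm_ge0_le; first by apply/lsub_ge0/a_dec.
by apply: lleD; [exact: llexx | exact/lleN/hz].
Qed.

(** The element [a + b - f] is below both [a] and [b], hence below their meet. *)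
Lemma lsub_meet_le (f a b : X) : a [<=] f -> b [<=] f ->
  f - lmeet a b [<=] (f - a) + (f - b).
Proof.
move=> af bf; have h : a + b - f [<=] lmeet a b.
  apply: lleI; first by rewrite -addrA -[X in _ [<=] X]addr0; apply: lleD;
    [exact: llexx | rewrite -(subrr f); exact: lleD2r].
  by rewrite addrAC -[X in _ [<=] X]add0r; apply: lleD2r; rewrite -(subrr f); exact: lleD2r.
have := lleD (llexx f) (lleN h).
suff -> : f - (a + b - f) = f - a + (f - b) by [].
by rewrite opprB opprD addrA [RHS]addrACA.
Qed.

(* For fixed [n], meeting the splitters of the pairs (n, m), m > n, gives [a n]
   that carries almost all of [Z n f] but on which all later [Z m] are small.  The
   joins of the first [a n] increase below [f], hence are Cauchy, although the
   [m]-th step adds almost all of [Z m f]. *)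
Lemma oc_split_null (Z : nat -> dual X) (M : R) (f : X) :
  positive_seq Z -> (forall n, `|Z n| <= M) -> 0 [<=] f ->
  (forall n m, (n < m)%N -> forall d : R, 0 < d ->
     exists g, [/\ 0 [<=] g, g [<=] f, Z n (f - g) <= d & Z m g <= d]) ->
  (fun n => Z n f : R) @ \oo --> (0 : R).
Proof.
move=> Z0 ZM f0 Zsplit.
have M0 : 0 <= M by exact: le_trans (ZM 0%N).
have ZB m x : Z m x <= M * `|x|.
  by rewrite (le_trans (ler_norm _))// (le_trans (ler_dual _ _))// ler_wpM2r.
(* The final estimate is [e + (1 + M) e + M e], that is [(2 + 2 M) e]. *)
apply/cvg0_epsP => e' e'0; pose e := e' / (2 + 2 * M).
have D0 : 0 < 2 + 2 * M by rewrite ltr_wpDr// mulr_ge0.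
have e0 : 0 < e by rewrite divr_gt0.
pose q n : R := 2^-1 ^+ n.
have q0 n : 0 < q n by rewrite exprn_gt0// invr_gt0.
have qS n : q n.+1 = q n / 2 by rewrite /q exprSr.
have q1 n : q n <= 1 by rewrite exprn_ile1// ?invr_ge0// invf_le1// ler1n.
(* The pair [(n, j)] encodes [n < m] with [m = n + j + 1]; the tolerances [e 2^-m] are summable. *)
have /choice[g hg] (nj : nat * nat) : exists g, [/\ 0 [<=] g, g [<=] f,
    Z nj.1 (f - g) <= e * q (nj.1 + nj.2).+1 & Z (nj.1 + nj.2).+1 g <= e * q (nj.1 + nj.2).+1].
  by apply: Zsplit; [rewrite ltnS leq_addr | rewrite mulr_gt0].
pose b n := fix b k := if k is k'.+1 then lmeet (b k') (g (n, k')) else f.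
have b0 n k : 0 [<=] b n k.
  by elim: k => //= k ih; apply: lleI => //; have [] := hg (n, k).
have bf n k : b n k [<=] f.
  by elim: k => [|k ih]; [exact: llexx | exact: lle_trans (lleIl _ _) ih].
have b_dec n k : b n k.+1 [<=] b n k by exact: lleIl.
have b_dec' n i j : (i <= j)%N -> b n j [<=] b n i.
  move=> /subnK<-; elim: (j - i)%N => [|m ih]; first exact: llexx.
  by rewrite addSn; exact: lle_trans (b_dec _ _) ih.
(* By [lsub_meet_le], each new meet costs at most [e q k.+1], and these costs add up to
   [e (1 - q k)]. *)
have Zb n k : Z n (f - b n k) <= e * (1 - q k).
  elim: k => [|k ih]; first by rewrite /q expr0 !subrr linear0 mulr0.
  have [_ gf gn _] := hg (n, k).
  apply: le_trans (dual_mono (Z0 n) (lsub_meet_le (bf n k) gf)) _.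
  rewrite linearD/=; have : q (n + k).+1 <= q k.+1.
    by rewrite -addnS /q exprD ler_piMl//; exact: q1.
  move=> /(ler_wpM2l (ltW e0)) h; have := le_trans gn h; rewrite /= qS.
  by move: ih => /= ih gk; lra.
(* The meets [b n] can be stopped at [K n], after which they move by at most [e q n.+1] in norm. *)
have /choice[K hK] n := oc_decreasing_cauchy (b0 n) (b_dec n) (mulr_gt0 e0 (q0 n.+1)).
pose a n := b n (K n).
have a0 n : 0 [<=] a n by exact: b0.
have Za n m : (n < m)%N -> Z m (a n) <= (1 + M) * e * q n.+1.
  (* This [j] is past [K n], so [b n j] is close to [a n], and past [m - n - 1], the position of the
     splitter of [(n, m)], so [Z m] is small on [b n j]. *)
  move=> nm; pose j := maxn (K n) (m - n); rewrite -(subrK (b n j) (a n)) linearD/=.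
  rewrite -mulrA mulrDl mul1r addrC lerD//; last first.
    by apply: le_trans (ZB _ _) _; rewrite ler_wpM2l// hK// leq_maxl.
  have mE : (n + (m - n.+1)).+1 = m by rewrite -addSn subnKC.
  have [_ _ _] := hg (n, (m - n.+1)%N); rewrite /= mE => h.
  have bg : b n j [<=] g (n, (m - n.+1)%N).
    apply: lle_trans (lleIr (b n (m - n.+1)%N) _); apply: (b_dec' n (m - n.+1).+1).
    by rewrite subnSK// leq_maxr.
  apply: le_trans (dual_mono (Z0 m) bg) (le_trans h _); rewrite ler_pM2l//.
  by rewrite -(subnKC nm) /q exprD ler_piMr//; exact: q1.
pose c := fix c k := if k is k'.+1 then ljoin (c k') (a k'.+1) else a 0%N.
have cf k : c k [<=] f by elim: k => [|k ih] /=; [|apply: lleU]; rewrite ?ih//; exact: bf.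
have c0 k : 0 [<=] c k.
  by elim: k => //= k ih; apply: lle_trans ih (lleUl _ _).
have Zc k m : (k < m)%N -> Z m (c k) <= (1 + M) * e * (1 - q k.+1).
  elim: k => [|k ih] km.
    by have := Za _ _ km; rewrite !qS /q expr0 (_ : 1 - 1 / 2 = 1 / 2 :> R)//; lra.
  apply: le_trans (dual_mono (Z0 m) (ljoin_leD (c0 k) (a0 _))) _.
  rewrite linearD/=; have := ih (ltnW km); have := Za _ _ km.
  rewrite (qS k.+1); set u := (1 + M) * e; set v := q k.+1; rewrite !mulrBr mulr1 mulrA.
  by move=> h1 h2; lra.
have e20 : 0 < e / 2 by rewrite divr_gt0.
have [k hk] := @oc_decreasing_cauchy (fun k => f - c k) (fun k => (lsub_ge0 _ _).2 (cf k))
  (fun k => lleD (llexx f) (lleN (lleUl _ _))) _ e20.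
exists k.+1 => -[//|m]; rewrite ltnS => km; rewrite ger0_norm; last exact: dual_ge0.
(* Three contributions remain: [f - a m.+1], small by [Zb]; [c m], small by [Zc]; and the increment
   [c m.+1 - c m], small in norm since [c] is Cauchy. *)
have -> : f = (f - a m.+1) + a m.+1 by rewrite subrK.
rewrite linearD/=.
have h1 := Zb m.+1 (K m.+1); rewrite -/(a m.+1) in h1.
have h2 : Z m.+1 (a m.+1) <= Z m.+1 (c m) + Z m.+1 (c m.+1 - c m).
  by rewrite -linearD/= addrC subrK; apply: dual_mono => //; exact: lleUr.
have h3 := Zc m m.+1 (ltnSn m).
have h4 : Z m.+1 (c m.+1 - c m) <= M * e.
  apply: le_trans (ZB _ _) _; rewrite ler_wpM2l//.
  have -> : c m.+1 - c m = ((f - c k) - (f - c m.+1)) - ((f - c k) - (f - c m)).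
    have tele (x y z : X) : y - x = (z - x) - (z - y).
      by rewrite opprB [RHS]addrC addrA subrK.
    by rewrite (tele _ _ f) (tele _ _ (f - c k)).
  apply: le_trans (ler_normB _ _) _; rewrite [e]splitr lerD// hk//.
  exact: leqW.
have h5 : e * (1 - q (K m.+1)) <= e by rewrite ger_pMr// gerBl ltW.
have h6 : (1 + M) * e * (1 - q m.+1) <= (1 + M) * e.
  by rewrite ger_pMr ?gerBl ?ltW// mulr_gt0// ltr_wpDr.
have <- : (2 + 2 * M) * e = e' by rewrite mulrC divfK// gt_eqF.
apply: (@le_trans _ _ (e + ((1 + M) * e + M * e))); last by lra.
by apply: lerD (le_trans h1 h5) (le_trans h2 (lerD (le_trans h3 h6) h4)).
Qed.

End OrderContinuity.

(** * The Dodds-Fremlin criterion *)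

Section DoddsFremlin.
Context {R : realType} {E : banachLatticeType R}.

(** Since [|f x|] is at most [f (labs x)], the norm is already determined on the positive part of
    the ball; the factor 2 replaces attainment of the supremum. *)
Lemma positive_dual_norming (f : dual E) : 0 [<=] f ->
  exists x, [/\ 0 [<=] x, `|x| <= 1 & `|f| <= 2 * f x].
Proof.
move=> f0; apply: contrapT => /forallNP h.
have hx x : 0 [<=] x -> `|x| <= 1 -> 2 * f x < `|f|.
  by move=> x0 x1; rewrite ltNge; apply/negP => fx; exact: h (And3 x0 x1 fx).
have f_gt0 : 0 < `|f|.
  by have := hx 0 (llexx _); rewrite normr0 linear0 mulr0; apply.
suff : `|f| <= `|f| / 2 by move=> ?; lra.
apply: dual_norm_le => [|x]; first by rewrite divr_ge0.
have [->|x0] := eqVneq x 0; first by rewrite linear0 !normr0 mulr0.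
have nx : 0 < `|x| by rewrite normr_gt0.
apply: le_trans (dual_le_norm_abs _ f0) _.
have n0 : 0 [<=] `|x|^-1 *: labs x.
  by apply: lscale_ge0 (labs_ge0 _); rewrite invr_ge0.
have := hx _ n0; rewrite normrZ normfV normr_id lnorm_abs mulVf ?gt_eqF//.
rewrite linearZ/= => /(_ (lexx _))/ltW.
by rewrite mulrCA ler_pdivrMl// => ?; lra.
Qed.

(** If the norms stay above [e] along a subsequence, almost norming positive vectors [w] are made
    disjoint by cutting off multiples of the earlier ones, through [s n], and of the later ones,
    through [X]. Weak*-nullity makes both cuts cheap, so the disjoint vectors violate the test. *)
Lemma dodds_fremlin (f : nat -> dual E) : positive_seq f -> weakstar_null f ->
  (forall (phi : nat -> nat) (u : nat -> E), {homo phi : i j / (i < j)%N} ->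
     positive_seq u -> disjoint_seq u -> (forall n, `|u n| <= 1) ->
     (fun n => f (phi n) (u n) : R) @ \oo --> (0 : R)) ->
  norm_null f.
Proof.
move=> f0 fw H; apply: contrapT => nf.
have [e e0 he] : exists2 e : R, 0 < e & forall N, exists n, (N <= n)%N /\ e <= `|f n|.
  apply: contrapT => h; apply: nf; apply/cvg0_epsP => e e0.
  apply: contrapT => /forallNP nN; apply: h; exists e => // N.
  have /existsNP[n /not_implyP[Nn /negP]] := nN N.
  by rewrite -ltNge => /ltW en; exists n.
have /choice[x hx] n := positive_dual_norming (f0 n).
(* A state [t] holds the stage, the last chosen index and the sum of the vectors chosen so far;
   weak*-nullity at this sum pays for the weight [4 ^+ t.1.+1]. *)
have /choice[next hnext] (t : nat * (nat * E)) : exists k, [/\ (t.2.1 < k)%N,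
    e <= `|f k| & 4 ^+ t.1.+1 * f k t.2.2 <= e / 4].
  case: t => j [k s] /=.
  have p0 : 0 < (4 : R) ^+ j.+1 by rewrite exprn_gt0.
  have /cvg0_epsP/(_ (e / 4 / 4 ^+ j.+1))[|N hN] := fw s; first by rewrite !divr_gt0.
  have [n [Nn en]] := he (maxn N k.+1); exists n; split=> //.
    by apply: leq_trans Nn; rewrite leq_maxr.
  rewrite mulrC -ler_pdivlMr// (le_trans (ler_norm _))// hN//.
  by apply: leq_trans Nn; rewrite leq_maxl.
pose st := fix st n : nat * E := if n is n'.+1 then
  let k := next (n', st n') in (k, (st n').2 + x k) else (0%N, x 0%N).
pose phi n := (st n).1; pose s n := (st n).2; pose w n := x (phi n).
have phiS n : [/\ (phi n < phi n.+1)%N, e <= `|f (phi n.+1)| &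
    4 ^+ n.+1 * f (phi n.+1) (s n) <= e / 4] by have := hnext (n, st n).
have phi_inc : {homo phi : i j / (i < j)%N}.
  by apply: homo_ltn => [i j k|n]; [exact: ltn_trans | case: (phiS n)].
have w0 n : 0 [<=] w n by case: (hx (phi n)).
have w1 n : `|w n| <= 1 by case: (hx (phi n)).
have s0 n : 0 [<=] s n.
  by elim: n => [|n ih]; [exact: (w0 0%N) | exact: laddr_ge0 ih (w0 n.+1)].
have ws n m : (n <= m)%N -> w n [<=] s m.
  elim: m => [|m ih]; first by rewrite leqn0 => /eqP->; exact: llexx.
  rewrite leq_eqVlt => /predU1P[->|/ih h].
    by rewrite -[X in X [<=] _]add0r; exact: lleD (s0 m) (llexx _).
  exact: lleD_ge0 h (w0 m.+1).
have [X X0 wX] := dyadic_dominated w0 w1.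
pose p n : R := 2^-1 ^+ n.
have p0 n : 0 < p n by rewrite exprn_gt0// invr_gt0.
have p1 n : p n <= 1 by rewrite exprn_ile1// ?invr_ge0// invf_le1// ler1n.
pose v n := w n.+1 - 4 ^+ n.+1 *: s n - p n.+1 *: X.
pose y n := lpos (v n).
have q0 n : 0 [<=] (4 ^+ n.+1 : R) *: s n.
  by apply: lscale_ge0 => //; rewrite exprn_ge0.
have pX0 n : 0 [<=] p n.+1 *: X by apply: lscale_ge0 X0; exact: ltW.
have yw n : y n [<=] w n.+1.
  by apply: lpos_le => //; do 2 (apply: lleB_ge0 => //); exact: llexx.
have y0 : positive_seq y by move=> n; exact: lpos_ge0.
have y1 n : `|y n| <= 1 by apply: le_trans (w1 n.+1); exact: lnorm_ge0_le.
have yd : disjoint_seq y.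
  apply: positive_disjointP => // n m nm.
  (* Claim: [y n] is below [lpos d] and [y m] below [lneg d]. The latter holds as [s m] dominates
     [w n.+1]. For the former, [X] dominates [2^-(m+1) w m.+1], so [v n] is below [q d], where
     [q 4^(m+1)] is at least 1 because [n < m], and [q] is at most 1. *)
  pose d : E := (4 ^+ m.+1 : R) *: w n.+1 - w m.+1.
  apply: lmeet_eq0_le (lmeet_pos_neg d) => //; last first.
    apply: lpos_mono; rewrite opprB; apply: lleB_ge0 => //; apply: lleD; first exact: llexx.
    by apply/lleN/lleZ; [rewrite exprn_ge0 | exact: ws].
  pose q := p n.+1 * p m.+1.
  have q_gt0 : 0 < q by rewrite mulr_gt0.
  have h : v n [<=] q *: d.
    apply: (@lle_trans _ _ (w n.+1 - q *: w m.+1)).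
      apply: lleD; last by rewrite -scalerA; apply/lleN/lleZ; [exact: ltW|exact: wX].
      by apply: lleB_ge0 => //; exact: llexx.
    rewrite scalerBr; apply: lleD2r; rewrite scalerA.
    rewrite -{1}[w n.+1]scale1r; apply/lsub_ge0; rewrite -scalerBl.
    apply: lscale_ge0 => //; rewrite subr_ge0 /q /p -exprD exprVn.
    rewrite ler_pdivlMl ?exprn_gt0// mulr1 (_ : 4 = 2 ^+ 2 :> R); last by rewrite -natrX.
    rewrite -exprM ler_eXn2l ?ltr1n//.
    by rewrite mul2n -addnn leq_add2r ltnW.
  apply: lle_trans (lpos_mono h) _; rewrite lposZ// -[X in _ [<=] X]scale1r.
  apply/lsub_ge0; rewrite -scalerBl; apply: lscale_ge0 (lpos_ge0 _).
  by rewrite subr_ge0 mulr_ile1// ltW.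
have phiS_inc : {homo (fun n => phi n.+1) : i j / (i < j)%N}.
  by move=> i j ij; exact: phi_inc.
have /cvg0_epsP hy := H _ _ phiS_inc y0 yd y1.
have /cvg0_epsP hX := cvg0_comp phiS_inc (fw X).
(* The functional is at least [e / 2] on [w n.+1] and loses at most [e / 4] to [s n] and [e / 16] to
   [X]; what is left exceeds [e / 16]. *)
have e16 : 0 < e / 16 by rewrite divr_gt0.
have [[N hN] [N' hN']] := (hy _ e16, hX _ e16).
have := hN _ (leq_maxl N N'); have := hN' _ (leq_maxr N N'); set n := maxn N N' => /=.
set g := f (phi n.+1) => /(le_trans (ler_norm _)) gX /(le_trans (ler_norm _)) gy.
have [_ en gs] := phiS n; have [_ _] := hx (phi n.+1); rewrite -/g -/(w _) in gs en *.
move=> gw; have : g (v n) <= g (y n) by apply: dual_mono (lleUl _ _); exact: f0.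
have -> : g (v n) = g (w n.+1) - 4 ^+ n.+1 * g (s n) - p n.+1 * g X.
  by rewrite /v !linearB !linearZ.
have : p n.+1 * g X <= g X by rewrite ler_piMl//; exact: dual_ge0 (f0 _) X0.
move: (4 ^+ n.+1 * g (s n)) (p n.+1 * g X) gs => a b gs.
move: (g (w n.+1)) (g X) (g (y n)) (`|g|) gX gy en gw => c i j k *; lra.
Qed.

End DoddsFremlin.

(** * Weak and weak*-nullity of disjoint bounded sequences *)

Section DisjointNull.
Context {R : realType}.

(** Kantorovich extension from the cone: additivity makes [p x - p y] depend on [x - y] only, so the
    difference of the values at the two parts is linear. *)
Lemma dual_of_cone (E : banachLatticeType R) (p : E -> R) (M : R) :
  (forall x, 0 [<=] x -> 0 <= p x <= M * `|x|) ->
  (forall x y, 0 [<=] x -> 0 [<=] y -> p (x + y) = p x + p y) ->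
  (forall a x, 0 < a -> 0 [<=] x -> p (a *: x) = a * p x) ->
  exists g : dual E, forall x, 0 [<=] x -> g x = p x.
Proof.
move=> pM pD pZ.
have p0 : p 0 = 0.
  by apply/eqP; rewrite eq_le andbC; have := pM 0 (llexx _); rewrite normr0 mulr0.
pose g x : R^o := p (lpos x) - p (lneg x).
have gB x y : 0 [<=] x -> 0 [<=] y -> g (x - y) = p x - p y.
  move=> x0 y0; have [u0 v0] := (lpos_ge0 (x - y), lneg_ge0 (x - y)).
  have : lpos (x - y) + y = x + lneg (x - y).
    by rewrite -[X in X + lneg _](subrK y) -{2}(lposBneg (x - y)) addrAC subrK.
  by move=> /(congr1 p); rewrite !pD// /g => ?; lra.
have gD x y : g (x + y) = g x + g y.
  rewrite -[in LHS](lposBneg x) -[in LHS](lposBneg y) addrACA -opprD.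
  have [? ?] := (lpos_ge0 x, lneg_ge0 x); have [? ?] := (lpos_ge0 y, lneg_ge0 y).
  by rewrite gB; [rewrite !pD// opprD addrACA|exact: laddr_ge0|exact: laddr_ge0].
have gN x : g (- x) = - g x.
  by rewrite -[in LHS](lposBneg x) opprB gB ?opprB//; [exact: lneg_ge0|exact: lpos_ge0].
have gZ a x : 0 < a -> g (a *: x) = a * g x.
  move=> a0; have [? ?] := (lpos_ge0 x, lneg_ge0 x).
  rewrite -[in LHS](lposBneg x) scalerBr gB; [|exact: lscale_ge0 (ltW a0) _..].
  by rewrite !pZ// -mulrBr.
have gl : linear g.
  move=> a x y; rewrite gD; congr (_ + _); have [a0|a0|->] := ltgtP a 0.
  - by rewrite -[a]opprK scaleNr gN gZ ?oppr_gt0// scaleNr.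
  - exact: gZ.
  - by rewrite !scale0r /g /lneg oppr0 subrr.
have gb : exists M', forall x, `|g x| <= M' * `|x|.
  exists (`|M| + `|M|) => x; rewrite (le_trans (ler_normB _ _))// mulrDl.
  have h z : 0 [<=] z -> `|z| <= `|x| -> `|p z| <= `|M| * `|x|.
    move=> /pM/andP[z0 zM] zx; rewrite ger0_norm// (le_trans zM)//.
    by apply: le_trans (ler_wpM2l (normr_ge0 M) zx); rewrite ler_wpM2r// ler_norm.
  by rewrite lerD// h//; [exact: lpos_ge0|exact: lnorm_pos|exact: lneg_ge0|exact: lnorm_neg].
exists (mk_dual gl gb) => x x0; have := gB x 0 x0 (llexx _).
by rewrite !subr0 p0 subr0.
Qed.

(* [g] is the restriction of [f] to the band generated by [x], extended by 0 on
   the disjoint complement. *)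
Lemma disjoint_band_functional (E : banachLatticeType R) (f : dual E) (x y : E) :
  0 [<=] f -> 0 [<=] x -> 0 [<=] y -> lmeet x y = 0 ->
  exists g : dual E, [/\ 0 [<=] g, g [<=] f, g x = f x & g y = 0].
Proof.
move=> f0 x0 y0 xy.
(* [S t] is the order interval from 0 to [t] cut down to the ideal generated by [x]; Riesz
   decomposition makes the supremum [p] additive. *)
pose S t := [set z | [/\ 0 [<=] z, z [<=] t & exists2 c : R, 0 < c & z [<=] c *: x]].
pose p t := sup [set f z | z in S t].
have S0 t : 0 [<=] t -> S t 0.
  by move=> t0; split=> //; [exact: llexx | exists 1; rewrite ?scale1r].
have Sup t : 0 [<=] t -> has_sup [set f z | z in S t].
  move=> t0; split; first by exists (f 0), 0 => //; exact: S0.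
  by exists (f t) => _ [z [_ zt _] <-]; exact: dual_mono.
have p_ub t z : 0 [<=] t -> S t z -> f z <= p t.
  by move=> t0 tz; apply: ub_le_sup; [exact: (Sup t t0).2 | exists z].
have p_le t C : 0 [<=] t -> (forall z, S t z -> f z <= C) -> p t <= C.
  by move=> t0 h; apply: ge_sup; [exact: (Sup t t0).1 | move=> _ [z tz <-]; exact: h].
have pf t : 0 [<=] t -> p t <= f t.
  by move=> t0; apply: p_le => // z [_ zt _]; exact: dual_mono.
have p_ge0 t : 0 [<=] t -> 0 <= p t.
  by move=> t0; have := p_ub t 0 t0 (S0 t t0); rewrite linear0.
have pM t : 0 [<=] t -> 0 <= p t <= `|f| * `|t|.
  move=> t0; rewrite p_ge0//= (le_trans (pf t t0))//.
  by rewrite (le_trans (ler_norm _))// ler_dual.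
have pD t u : 0 [<=] t -> 0 [<=] u -> p (t + u) = p t + p u.
  move=> t0 u0; have tu0 := laddr_ge0 t0 u0; apply/eqP; rewrite eq_le; apply/andP; split.
    apply: p_le => // z [z0 ztu [c c0 zc]].
    have [z1 [z2 [zE [z10 z1t] [z20 z2u]]]] := lriesz z0 t0 u0 ztu.
    rewrite zE linearD/= lerD// p_ub//; split=> //; exists c => //.
      by apply: lle_trans zc; rewrite zE; exact: lleD_ge0 (llexx _) z20.
    by apply: lle_trans zc; rewrite zE addrC; exact: lleD_ge0 (llexx _) z10.
  rewrite -lerBrDr; apply: (p_le) => // z [z0 zt [c c0 zc]].
  rewrite lerBrDr addrC -lerBrDr; apply: p_le => // z' [z'0 z'u [c' c'0 z'c]].
  rewrite lerBrDr -linearD/= addrC; apply: p_ub => //; split.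
  - exact: laddr_ge0.
  - exact: lleD.
  - by exists (c + c'); [exact: addr_gt0 | rewrite scalerDl; exact: lleD].
have pZ_le a t : 0 < a -> 0 [<=] t -> a * p t <= p (a *: t).
  move=> a0 t0; rewrite -ler_pdivlMl//; apply: p_le => // z [z0 zt [c c0 zc]].
  rewrite ler_pdivlMl//; have -> : a * f z = f (a *: z) by rewrite linearZ.
  apply: p_ub; first exact: lscale_ge0 (ltW a0) t0.
  split; [exact: lscale_ge0 (ltW a0) z0 | exact: lleZ (ltW a0) zt |].
  by exists (a * c); [exact: mulr_gt0 | rewrite -scalerA; exact: lleZ (ltW a0) zc].
have pZ a t : 0 < a -> 0 [<=] t -> p (a *: t) = a * p t.
  move=> a0 t0; apply/eqP; rewrite eq_le pZ_le// andbT.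
  have a0' : 0 < a^-1 by rewrite invr_gt0.
  have := pZ_le _ _ a0' (lscale_ge0 (ltW a0) t0).
  by rewrite scalerA mulVf ?gt_eqF// scale1r ler_pdivrMl.
have [g hg] := dual_of_cone pM pD pZ; exists g; split.
- by move=> t t0; rewrite hg//; exact: p_ge0.
- by move=> t t0; rewrite hg//; exact: pf.
- rewrite hg//; apply/eqP; rewrite eq_le pf//= p_ub//; split=> //; first exact: llexx.
  by exists 1; rewrite ?scale1r//; exact: llexx.
- rewrite hg//; apply/eqP; rewrite eq_le p_ge0// andbT; apply: p_le => // z [z0 zy [c c0 zc]].
  suff -> : z = 0 by rewrite linear0.
  have c1 : 0 < 1 + c by rewrite ltr_wpDl.
  (* From [z] below [y] and below [c x], the element [z / (1 + c)] is below both [x] and [y], whose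
     meet is 0. *)
  suff : (1 + c)^-1 *: z [<=] 0.
    move=> /(lleZ (ltW c1)); rewrite scalerA mulfV ?gt_eqF// scale1r scaler0.
    by move=> zle; exact: lle_anti.
  have key t : z [<=] t + c *: t -> (1 + c)^-1 *: z [<=] t.
    rewrite -{1}[t]scale1r -scalerDl => /(lleZ (a := (1 + c)^-1)).
    by rewrite scalerA mulVf ?gt_eqF// scale1r; apply; rewrite invr_ge0 ltW.
  rewrite -xy; apply: lleI; apply: key; last exact: lleD_ge0 (lscale_ge0 (ltW c0) y0).
  by rewrite addrC; exact: lleD_ge0 x0.
Qed.

(** Disjointness means that the positive part of [Z - W] is [Z], so by the Riesz-Kantorovich formula
    [Z f] is the supremum of [(Z - W) g] over [g] between 0 and [f]. A [g] within [d] of it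
    satisfies [Z (f - g) + W g <= d]. *)
Lemma disjoint_dual_split (X : banachLatticeType R) (Z W : dual X) (f : X) (d : R) :
  0 [<=] Z -> 0 [<=] W -> lmeet Z W = 0 -> 0 [<=] f -> 0 < d ->
  exists g, [/\ 0 [<=] g, g [<=] f, Z (f - g) <= d & W g <= d].
Proof.
move=> Z0 W0 ZW f0 d0; pose P := dual_pos (- W - - Z).
have PZ : P f = Z f.
  have : dual_meet W Z f = 0 by rewrite -[dual_meet W Z]/(lmeet W Z) lmeetC ZW.
  by rewrite /dual_meet /dual_join dualNE dualDE dualNE => ?; rewrite /P; lra.
have Sup : has_sup [set (- W - - Z) y | y in [set y : X | 0 [<=] y /\ y [<=] f]].
  split; first by exists ((- W - - Z) 0), 0 => //; split=> //; exact: llexx.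
  exists (`|- W - - Z| * `|f|) => _ [y [y0 yf] <-].
  rewrite (le_trans (ler_norm _))// (le_trans (ler_dual _ _))// ler_wpM2l//.
  exact: lnorm_ge0_le.
have [_ [g [g0 gf] <-]] := sup_adherent d0 Sup.
rewrite -dual_posE// -/P PZ dualDE !dualNE opprK => hg; exists g.
have := dual_mono Z0 gf; have := dual_ge0 W0 g0.
by split; rewrite ?linearB//=; lra.
Qed.

Lemma disjoint_weakstar_null (X : banachLatticeType R) (Z : nat -> dual X) (M : R) :
  order_continuous_norm X -> positive_seq Z -> disjoint_seq Z ->
  (forall n, `|Z n| <= M) -> weakstar_null Z.
Proof.
move=> oc Z0 Zd ZM; apply: dual_cvg0_ge0 => x x0.
apply: (oc_split_null oc Z0 ZM x0) => n m nm d d0.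
by apply: disjoint_dual_split => //; apply: disjoint_labs => //; rewrite neq_ltn nm.
Qed.

(** Embedded in the bidual, [u] is a sequence of functionals on [dual E], to which [oc_split_null]
    applies. The splitter for [n < m] is a band restriction of [f] that agrees with [f] at [u n] and
    vanishes at [u m]. *)
Lemma disjoint_weakly_null (E : banachLatticeType R) (u : nat -> E) (M : R) :
  order_continuous_norm (dual E) -> positive_seq u -> disjoint_seq u ->
  (forall n, `|u n| <= M) -> weakly_null u.
Proof.
move=> oc u0 ud uM; pose Z n := dual_eval (u n).
have ZM n : `|Z n| <= M by exact: le_trans (dual_eval_norm_le _) (uM n).
have Z0 : positive_seq Z by move=> n; exact: dual_eval_ge0.
apply: (@dual_cvg0_ge0 _ _ Z) => f f0.
apply: (oc_split_null oc Z0 ZM f0) => n m nm d d0.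
have unm : lmeet (u n) (u m) = 0 by apply: disjoint_labs => //; rewrite neq_ltn nm.
have [g [g0 gf gn gm]] := disjoint_band_functional f0 (u0 n) (u0 m) unm.
exists g; split=> //; last by rewrite [Z m g]gm ltW.
by rewrite [Z n _](dualBE f g) gn subrr ltW.
Qed.

End DisjointNull.

(** * From weak*-nullity to norm nullity in the bidual of [F] *)

Lemma bounded_fun_norm_ub (R : realType) (V : normedModType R) (u : nat -> V) :
  bounded_fun u -> exists2 M : R, 0 < M & forall n, `|u n| <= M.
Proof.
move=> /pinfty_ex_gt0[M M0 hM]; exists M => // n; exact: hM.
Qed.

(** Under the first alternative a disjoint bounded [u] has an upper bound [b], so the Dodds-Fremlin
    test values are at most [f (p n) b], which tends to 0. The second alternative is the claim
    itself. *)
Lemma weakstar_null_norm_null (R : realType) (F : banachLatticeType R)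
    (f : nat -> dual (dual F)) :
  (forall u : nat -> dual F, positive_seq u -> disjoint_seq u -> bounded_fun u ->
     order_bounded_seq u) \/ dual_positive_schur (dual F) ->
  positive_seq f -> weakstar_null f -> norm_null f.
Proof.
move=> [hb|hs] f0 fw; last exact: hs.
apply: dodds_fremlin => // p u p_inc u0 ud u1.
have ub : bounded_fun u.
  by exists 1; split=> // x x1 n _; exact: le_trans (u1 n) (ltW x1).
have [a [b ubb]] := hb _ u0 ud ub.
apply: (@cvg0_dominated _ _ _ _ ((fun n => f n b : R) \o p) 1); last first.
  exact: cvg0_comp (fw b).
move=> n; rewrite mul1r /= ger0_norm; last exact: dual_ge0.
by apply: le_trans (ler_norm _); apply: dual_mono => //; case: (ubb n).
Qed.

(** * Iterated extensions of an abstract slice map [phi], covering both permutations *)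

Section IteratedNull.
Context {R : realType} {F G H : banachLatticeType R}.
Context {phi : {bilinear dual F -> G -> dual H}} (phib : bounded_bilinear phi).
Hypothesis phi_ge0 : forall y x, 0 [<=] y -> 0 [<=] x -> 0 [<=] phi y x.
Hypothesis ocG : order_continuous_norm (dual G).
Hypothesis ocH : order_continuous_norm (dual H).
Hypothesis phi_disjoint : forall (y : dual F) (v : nat -> G) (u : nat -> H),
  0 [<=] y -> positive_seq v -> disjoint_seq v -> (forall n, `|v n| <= 1) ->
  positive_seq u -> disjoint_seq u -> (forall n, `|u n| <= 1) ->
  (fun n => phi y (v n) (u n) : R) @ \oo --> (0 : R).

Hypothesis hF : (forall u : nat -> dual F, positive_seq u -> disjoint_seq u ->
  bounded_fun u -> order_bounded_seq u) \/ dual_positive_schur (dual F).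

Lemma iter_inner_ge0 z y : 0 [<=] z -> 0 [<=] y -> 0 [<=] iter_inner phib z y.
Proof. by move=> z0 y0; apply/dual_lleP => x x0; exact: dual_ge0 z0 (phi_ge0 y0 x0). Qed.

Lemma iter_ext_ge0 z w : 0 [<=] z -> 0 [<=] w -> 0 [<=] iter_ext phib z w.
Proof. by move=> z0 w0; apply/dual_lleP => y y0; exact: dual_ge0 w0 (iter_inner_ge0 z0 y0). Qed.

Lemma slice_norm_null y v : 0 [<=] y -> positive_seq v -> disjoint_seq v ->
  (forall n, `|v n| <= 1) -> norm_null (fun n => phi y (v n)).
Proof.
move=> y0 v0 vd v1; apply: dodds_fremlin => [n|x|p u p_inc u0 ud u1].
- exact: phi_ge0.
(* The value of [phi y (v n)] at [x] is a fixed functional on [G] evaluated at [v n]. *)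
- exact: (disjoint_weakly_null ocG v0 vd v1 (iter_inner phib (dual_eval x) y)).
- apply: (@phi_disjoint y (v \o p) u) => //= [n|n k nk]; first exact: v0.
  apply: vd; move: nk; rewrite neq_ltn => /orP[/p_inc|/p_inc] h.
    by rewrite neq_ltn h.
  by rewrite neq_ltn h orbT.
Qed.

(** On disjoint [v] in the ball, the test values are at most [M] times the norm of [phi y (v n)], so
    [slice_norm_null] applies. *)
Lemma iter_inner_norm_null y (z : nat -> dual (dual H)) (M : R) :
  0 [<=] y -> positive_seq z -> weakstar_null z -> (forall n, `|z n| <= M) ->
  norm_null (fun n => iter_inner phib (z n) y).
Proof.
move=> y0 z0 zw zM; apply: dodds_fremlin => [n|x|p v p_inc v0 vd v1].
- exact: iter_inner_ge0.
- exact: (zw (phi y x)).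
apply: (@cvg0_dominated _ _ _ _ (fun n => phi y (v n)) M); last exact: slice_norm_null.
by move=> n; apply: le_trans (ler_dual (z (p n)) _) _; rewrite ler_wpM2r.
Qed.

Let outer_linear y w : linear (fun z => iter_ext phib z w y : R^o).
Proof. by move=> a u v; rewrite (iter_ext_bilinear phib).1. Qed.

Let outer_bounded y w : exists M, forall z, `|iter_ext phib z w y| <= M * `|z|.
Proof.
have [M hM] := phib; exists (`|w| * (`|M| * `|y|)) => z.
apply: le_trans (ler_dual w _) _; rewrite -mulrA ler_wpM2l//.
apply: dual_norm_le => [|x]; first by rewrite !mulr_ge0.
apply: le_trans (ler_dual z _) _; rewrite mulrC mulrAC ler_wpM2r//.
by apply: le_trans (hM _ _) _; rewrite -!mulrA ler_wpM2r ?mulr_ge0// ler_norm.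
Qed.

(** With [z] as the variable, the norm in the third dual controls the extension at [y] uniformly
    over bounded [z]. *)
Let outer y w : dual (dual (dual H)) := mk_dual (outer_linear y w) (outer_bounded y w).

Lemma outer_norm_null y (w : nat -> dual (dual G)) :
  0 [<=] y -> positive_seq w -> weakstar_null w -> norm_null (fun n => outer y (w n)).
Proof.
move=> y0 w0 ww; have [M _ wM] := weakstar_null_bounded ww.
apply: dodds_fremlin => [n|z|p z p_inc z0 zd z1].
- by apply/dual_lleP => z z0; exact: dual_ge0 (iter_ext_ge0 z0 (w0 n)) y0.
- exact: (ww (iter_inner phib z y)).
have zw := disjoint_weakstar_null ocH z0 zd z1.
apply: (@cvg0_dominated _ _ _ _ (fun n => iter_inner phib (z n) y) M).
  by move=> n; apply: le_trans (ler_dual (w (p n)) _) _; rewrite ler_wpM2r.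
exact: iter_inner_norm_null z1.
Qed.

Lemma iter_ext_null_left (z : nat -> dual (dual H)) (w : nat -> dual (dual G)) :
  positive_seq z -> weakstar_null z -> positive_seq w -> bounded_fun w ->
  norm_null (fun n => iter_ext phib (z n) (w n)).
Proof.
move=> z0 zw w0 /bounded_fun_norm_ub[M _ wM].
apply: (weakstar_null_norm_null hF) => [n|]; first exact: iter_ext_ge0.
apply: dual_cvg0_ge0 => y y0; have [C _ zC] := weakstar_null_bounded zw.
apply: (@cvg0_dominated _ _ _ _ (fun n => iter_inner phib (z n) y) M).
  by move=> n; apply: le_trans (ler_dual (w n) _) _; rewrite ler_wpM2r.
exact: iter_inner_norm_null zC.
Qed.

Lemma iter_ext_null_right (z : nat -> dual (dual H)) (w : nat -> dual (dual G)) :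
  positive_seq z -> bounded_fun z -> positive_seq w -> weakstar_null w ->
  norm_null (fun n => iter_ext phib (z n) (w n)).
Proof.
move=> z0 /bounded_fun_norm_ub[M _ zM] w0 ww.
apply: (weakstar_null_norm_null hF) => [n|]; first exact: iter_ext_ge0.
apply: dual_cvg0_ge0 => y y0.
apply: (@cvg0_dominated _ _ _ _ (fun n => outer y (w n)) M); last exact: outer_norm_null.
by move=> n; apply: le_trans (ler_dual (outer y (w n)) _) _; rewrite mulrC ler_wpM2r.
Qed.

End IteratedNull.

(** Positive and negative parts of a disjoint weakly null sequence stay disjoint and bounded, hence
    weak*-null in the first variable by order continuity of the norm of [X1]. Bilinearity reduces
    the claim to the four combinations of parts. *)
Lemma weakly_positively_limited_adp (R : realType) (X1 X2 : banachLatticeType R)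
    (G : completeNormedModType R) (B : {bilinear dual X1 -> dual X2 -> G}) :
  order_continuous_norm X1 -> weakly_positively_limited B -> almost_dunford_pettis B.
Proof.
have weakW (X : banachLatticeType R) (u : nat -> dual X) : weakly_null u -> weakstar_null u.
  by move=> uw x; exact: (uw (dual_eval x)).
move=> oc [BL _] u v ud /weakW/weakstar_null_bounded[M M0 uM] vd.
move=> /weakW/weakstar_null_bounded[C _ vC].
have bv (t : dual X2 -> dual X2) : (forall x, `|t x| <= `|x|) -> bounded_fun (t \o v).
  move=> th; exists C; split; first by rewrite num_real.
  by move=> x Cx n _; exact: le_trans (th _) (le_trans (vC n) (ltW Cx)).
have up := disjoint_weakstar_null oc (fun n => lpos_ge0 (u n)) (disjoint_lpos ud)
  (fun n => le_trans (lnorm_pos (u n)) (uM n)).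
have un := disjoint_weakstar_null oc (fun n => lneg_ge0 (u n)) (disjoint_lneg ud)
  (fun n => le_trans (lnorm_neg (u n)) (uM n)).
have [vp vn] := (bv _ (@lnorm_pos _ _), bv _ (@lnorm_neg _ _)).
have p0 (X : banachLatticeType R) (w : nat -> X) : positive_seq (lpos \o w).
  by move=> n; exact: lpos_ge0.
have n0 (X : banachLatticeType R) (w : nat -> X) : positive_seq (lneg \o w).
  by move=> n; exact: lneg_ge0.
have pp := BL _ _ (p0 _ u) up (p0 _ v) vp; have pn := BL _ _ (p0 _ u) up (n0 _ v) vn.
have np := BL _ _ (n0 _ u) un (p0 _ v) vp; have nn := BL _ _ (n0 _ u) un (n0 _ v) vn.
rewrite /norm_null.
have -> : (fun n => B (u n) (v n)) = (fun n => (B (lpos (u n)) (lpos (v n)) -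
    B (lpos (u n)) (lneg (v n))) - (B (lneg (u n)) (lpos (v n)) - B (lneg (u n)) (lneg (v n)))).
  by apply/funext => n; rewrite -!linearBr -linearBl !lposBneg.
have -> : 0 = 0 - 0 - (0 - 0) :> G by rewrite !subr0.
exact: cvgB (cvgB pp pn) (cvgB np nn).
Qed.

Theorem theorem3p8 (R : realType) (E1 E2 F : banachLatticeType R)
    (A : {bilinear E1 -> E2 -> F})
    (oc1 : order_continuous_norm (dual E1))
    (oc2 : order_continuous_norm (dual E2))
    (A_pos : positive_bilinear A)
    (A_adp : almost_dunford_pettis A)
    (hF : (forall u : nat -> dual F,
             positive_seq u -> disjoint_seq u -> bounded_fun u ->
             order_bounded_seq u)
          \/ dual_positive_schur (dual F))
    (rho : 'S_2) :
  weakly_positively_limited (X1 := dual E1) (X2 := dual E2) (G := dual (dual F))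
    (aron_berner (positive_bilinear_bounded A_pos) rho) /\
  almost_dunford_pettis
    (E1 := dual (dual E1)) (E2 := dual (dual E2)) (G := dual (dual F))
    (aron_berner (positive_bilinear_bounded A_pos) rho).
Proof.
set Ab := positive_bilinear_bounded A_pos.
suff wpl : weakly_positively_limited (X1 := dual E1) (X2 := dual E2) (G := dual (dual F))
    (aron_berner Ab rho).
  by split=> //; exact: weakly_positively_limited_adp.
have A_disjoint (y : dual F) (u : nat -> E1) (v : nat -> E2) :
    positive_seq u -> disjoint_seq u -> (forall n, `|u n| <= 1) ->
    positive_seq v -> disjoint_seq v -> (forall n, `|v n| <= 1) ->
    (fun n => y (A (u n) (v n)) : R) @ \oo --> (0 : R).
  move=> u0 ud u1 v0 vd v1.
  apply: (@cvg0_dominated _ _ _ _ (fun n => A (u n) (v n)) `|y|).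
    by move=> n; exact: ler_dual.
  apply: A_adp => //; first exact: disjoint_weakly_null oc1 u0 ud u1.
  exact: disjoint_weakly_null oc2 v0 vd v1.
have s1_ge0 y x : 0 [<=] y -> 0 [<=] x -> 0 [<=] slice1 Ab y x.
  by move=> y0 x0; apply/dual_lleP => t t0; exact: dual_ge0 y0 (A_pos _ _ t0 x0).
have s2_ge0 y x : 0 [<=] y -> 0 [<=] x -> 0 [<=] slice2 Ab y x.
  by move=> y0 x0; apply/dual_lleP => t t0; exact: dual_ge0 y0 (A_pos _ _ x0 t0).
have s1_disjoint y v u (y0 : 0 [<=] y) v0 vd v1 u0 ud u1 := @A_disjoint y u v u0 ud u1 v0 vd v1.
have s2_disjoint y u v (y0 : 0 [<=] y) u0 ud u1 v0 vd v1 := @A_disjoint y u v u0 ud u1 v0 vd v1.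
pose b1 := slice1_bounded_bilinear Ab; pose b2 := slice2_bounded_bilinear Ab.
(* The weak*-null sequence may be in either variable. The identity uses the first variable as the
   inner one, the transposition the second, so the left and right lemmas swap. *)
split=> f g f0 hf g0 hg; have [rho1|rho1] := boolP (rho == 1%g).
- have -> : (fun n => aron_berner Ab rho (f n) (g n)) = (fun n => iter_ext b1 (f n) (g n)).
    by rewrite /aron_berner rho1.
  exact: (iter_ext_null_left b1 s1_ge0 oc2 s1_disjoint hF f0 hf g0 hg).
- have -> : (fun n => aron_berner Ab rho (f n) (g n)) = (fun n => iter_ext b2 (g n) (f n)).
    by rewrite /aron_berner (negbTE rho1).
  exact: (iter_ext_null_right b2 s2_ge0 oc1 oc2 s2_disjoint hF g0 hg f0 hf).
- have -> : (fun n => aron_berner Ab rho (f n) (g n)) = (fun n => iter_ext b1 (f n) (g n)).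
    by rewrite /aron_berner rho1.
  exact: (iter_ext_null_right b1 s1_ge0 oc2 oc1 s1_disjoint hF f0 hf g0 hg).
- have -> : (fun n => aron_berner Ab rho (f n) (g n)) = (fun n => iter_ext b2 (g n) (f n)).
    by rewrite /aron_berner (negbTE rho1).
  exact: (iter_ext_null_left b2 s2_ge0 oc1 s2_disjoint hF g0 hg f0 hf).
Qed.
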